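(* There exists an absolute constant $C>0$ such that the following holds. Let $d,n\ge 1$ be integers, let $X_1,\ldots,X_n$ be iid random variables taking values in $\mathbb{R}^d$, and let $\mu$ denote their common distribution. For every real $m\in(0,n]$, there exists a randomized algorithm, possibly depending on $\mu$, that maps the points $X_1,\ldots,X_n$ to points $Y_1,\ldots,Y_n\in\mathbb{R}^d$ such that \[ \mathbb{E}\,\#\{i: Y_i\neq X_i\}\le m \] and \[ \mathbb{E}\,\sup_B\bigl|\mu_n^Y(B)-\mu(B)\bigr|\le \frac{C^d\,\log^{3d/2+1}(2n)}{m}, \] where $\mu_n^Y$ is the empirical measure of $Y_1,\ldots,Y_n$ and the supremum is over all lower orthants $B\subset\mathbb{R}^d$. The expectations are taken over both the sample $X_1,\ldots,X_n$ and the internal randomness of the algorithm.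
   Context: The empirical measure of points $Y_1,\ldots,Y_n\in\mathbb{R}^d$ is $\mu_n^Y(B)=\frac1n\sum_{i=1}^n \mathbf{1}_{\{Y_i\in B\}}$ for Borel sets $B\subset\mathbb{R}^d$. A lower orthant is a set of the form $B=(-\infty,t_1]\times\cdots\times(-\infty,t_d]$ with $(t_1,\ldots,t_d)\in\mathbb{R}^d$. A randomized algorithm is a procedure whose output is a (measurable) function of its input and of auxiliary internal randomness that is independent of the input; no computational efficiency is claimed. *)

(* Defs.v *)
From HB Require Import structures.
From mathcomp Require Import all_boot all_order all_algebra.
From mathcomp Require Import all_classical all_reals all_analysis.

Set Implicit Arguments.
Unset Strict Implicit.
Unset Printing Implicit Defensive.

Import Order.TTheory GRing.Theory Num.Theory.
Import numFieldNormedType.Exports.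

Local Open Scope classical_set_scope.
Local Open Scope ring_scope.

(* [R^d] is [d.-tuple R]: its canonical sigma-algebra is the one generated by
   the coordinate maps, i.e. the Borel sigma-algebra of [R^d]. *)

Section randomness.
Context {R : realType}.

(* Mutual independence: the product rule over every subfamily. *)
Definition mutually_independent d d' (Omega : measurableType d)
    (T : measurableType d') (P : probability Omega R) n
    (X : 'I_n -> {RV P >-> T}) : Prop :=
  forall (J : {set 'I_n}) (B : 'I_n -> set T),
    (forall i, measurable (B i)) ->
    P [set w | forall i, i \in J -> B i (X i w)] =
    (\prod_(i in J) P (X i @^-1` B i))%E.

Definition iid_with_law d d' (Omega : measurableType d)
    (T : measurableType d') (P : probability Omega R) n
    (X : 'I_n -> {RV P >-> T}) (mu : probability T R) : Prop :=
  mutually_independent X /\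
  forall i (B : set T), measurable B -> distribution P (X i) B = mu B.

(* The internal randomness is an arbitrary probability space; independence of
   the input is obtained by running the algorithm under a product law. *)
Record randomized_algorithm d d' (T : measurableType d)
    (U : measurableType d') := RandomizedAlgorithm {
  seed_display : measure_display;
  seed : measurableType seed_display;
  seed_law : probability seed R;
  run :> {mfun (T * seed)%type >-> U} }.

End randomness.

Arguments randomized_algorithm R {d d'} T U.

Section empirical.
Context {R : realType}.

Definition sample_of d d' (Omega : measurableType d) (T : measurableType d')
    (P : probability Omega R) n (X : 'I_n -> {RV P >-> T}) (w : Omega) :
    n.-tuple T :=
  [tuple X i w | i < n].

Definition empirical_measure (T : Type) n (y : n.-tuple T) (B : set T) : R :=
  n%:R^-1 * \sum_(i < n) \1_B (tnth y i).

Definition num_changed (T : eqType) n (x y : n.-tuple T) : nat :=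
  #|[pred i : 'I_n | tnth y i != tnth x i]|.

Definition lower_orthant d (t : d.-tuple R) : set (d.-tuple R) :=
  [set x | forall i : 'I_d, tnth x i <= tnth t i].

(* The real-valued [sup] is meaningful here: the set is nonempty, and it is
   bounded by 1 as both measures have total mass at most 1. *)
Definition orthant_discrepancy d n (mu : probability (d.-tuple R) R)
    (y : n.-tuple (d.-tuple R)) : R :=
  sup [set `|empirical_measure y B - fine (mu B)|
      | B in range (@lower_orthant d)].

End empirical.

(* Main.v *)
(* Cut each axis into O(n) cells which are singletons or have mass at most 1/n,
   so that only the cells of the points and the orthants made of cells matter.
   Process the points one after the other and replace the current X by an
   independent copy Z of law mu with probability
   (delta / 2) (1 + <S, b(X) - b(Z)> / c), clipped, where delta = m / n, b(x) is
   the vector of the indicators of the dyadic boxes of cells containing x, and S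
   is the sum of b(Y) - E b(X) over the previous outputs Y.  At most n delta = m
   points change on average.  The replacement gives S the drift
   - (delta / c) Cov(b(X)) S, which balances its quadratic variation whatever
   the law mu is; hence S stays subgaussian with variance proxy of order
   c / delta, in all directions.  Since an orthant is a disjoint union of at most
   O(log n)^d dyadic boxes, this bounds all orthant discrepancies, and also shows
   that clipping is unlikely, when c is of order d O(log n)^(d+1) / delta. *)

Require Import Defs.
From HB Require Import structures.
From mathcomp Require Import all_boot all_order all_algebra.
From mathcomp Require Import all_classical all_reals all_analysis.
From mathcomp Require Import measurable_realfun ring lra zify.

Import Order.TTheory GRing.Theory Num.Theory.
Import numFieldNormedType.Exports.

Local Open Scope classical_set_scope.
Local Open Scope ring_scope.

Set Implicit Arguments.
Unset Strict Implicit.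
Unset Printing Implicit Defensive.

(** * One step of the self-balancing walk *)

Section self_balancing.
Context {R : realType} {K : finType}.
Implicit Types (p s t : K -> R).

(** For the upper bound, exp t <= 1 / (1 - t), and (1 - t) (1 + t + 2 t^2) = 1 + t^2 (1 - 2 t) >=
    1. *)
Lemma expR_sub1_bound (t : R) : `|t| <= 2^-1 ->
  1 + t <= expR t <= 1 + t + 2 * t ^+ 2.
Proof.
rewrite ler_norml => /andP[t1 t2]; rewrite expR_ge1Dx /=.
have h : 1 - t <= expR (- t) by exact: expR_ge1Dx.
have h0 : 0 < 1 - t by lra.
rewrite -[leLHS]invrK -expRN.
apply: (@le_trans _ _ (1 - t)^-1); first by rewrite lef_pV2 ?posrE ?expR_gt0.
rewrite -[leLHS]mul1r ler_pdivrMr//.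
have := mulr_ge0 (sqr_ge0 t) (_ : 0 <= 1 - 2 * t); first lra; nra.
Qed.

(** Truncation makes the swap probability legitimate after every history; the moment bounds only use
    histories on which it is the identity. *)
Definition clip (r : R) : R := Num.max (-1) (Num.min 1 r).

Lemma clip_itv r : -1 <= clip r <= 1.
Proof. by rewrite /clip le_max lexx /= ge_max ge_min lexx /=; lra. Qed.

Lemma clip_id r : `|r| <= 1 -> clip r = r.
Proof. by rewrite ler_norml /clip => /andP[h1 h2]; rewrite (min_idPr h2) (max_idPr h1). Qed.

Definition swap_prob (delta c : R) s x z : R :=
  delta / 2 * (1 + clip ((s x - s z) / c)).

Lemma swap_prob_itv delta c s x z : 0 <= delta ->
  0 <= swap_prob delta c s x z <= delta.
Proof.
move=> d0; have /andP[h1 h2] := clip_itv ((s x - s z) / c).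
by rewrite /swap_prob; apply/andP; split; nra.
Qed.

(** A proposal [z] of law [p] is accepted with probability [q x z]; the second term is the
    probability of rejection, which leaves [x] in place. *)
Definition resample p (q : K -> K -> R) x y : R :=
  p y * q x y + (x == y)%:R * (1 - \sum_z p z * q x z).

Lemma sum_resample p q x (f : K -> R) :
  \sum_y resample p q x y * f y = f x + \sum_z p z * q x z * (f z - f x).
Proof.
under eq_bigr do rewrite /resample mulrDl.
rewrite big_split /=.
have stay r : \sum_y (x == y)%:R * r * f y = r * f x.
  rewrite (bigD1 x) //= eqxx mul1r big1 ?addr0 // => y.
  by rewrite eq_sym => /negPf ->; rewrite !mul0r.
rewrite stay.
under [in RHS]eq_bigr do rewrite mulrBr.
rewrite sumrB mulrBl mul1r mulr_suml.
ring.
Qed.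

Section law.
Variables (p : K -> R) (p_ge0 : forall x, 0 <= p x) (p_sum : \sum_x p x = 1).

Lemma resample_ge0 q x y : (forall x z, 0 <= q x z <= 1) -> 0 <= resample p q x y.
Proof.
move=> q01; rewrite /resample addr_ge0 ?mulr_ge0 ?subr_ge0 //.
  by case/andP: (q01 x y).
by rewrite -p_sum ler_sum // => z _; rewrite ler_piMr //; case/andP: (q01 x z).
Qed.

Lemma sum_resample1 q x : \sum_y resample p q x y = 1.
Proof.
have := sum_resample p q x (fun=> 1).
under eq_bigr do rewrite mulr1.
by move=> ->; rewrite big1 ?addr0 // => z _; rewrite subrr mulr0.
Qed.

Lemma sum_prod_law (f g : K -> R) :
  \sum_x \sum_z p x * p z * (f x * g z) =
  (\sum_x p x * f x) * (\sum_z p z * g z).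
Proof.
rewrite mulr_suml; apply: eq_bigr => x _; rewrite mulr_sumr.
by apply: eq_bigr => z _; ring.
Qed.

Lemma sum_prod_law_fst (f : K -> R) :
  \sum_x \sum_z p x * p z * f x = \sum_x p x * f x.
Proof.
have := sum_prod_law f (fun=> 1).
under [X in _ * X]eq_bigr do rewrite mulr1.
rewrite p_sum mulr1 => <-.
by apply: eq_bigr => x _; apply: eq_bigr => z _; rewrite mulr1.
Qed.

Lemma sum_prod_law_snd (f : K -> R) :
  \sum_x \sum_z p x * p z * f z = \sum_x p x * f x.
Proof.
rewrite exchange_big /= -sum_prod_law_fst.
by apply: eq_bigr => x _; apply: eq_bigr => z _; ring.
Qed.

(* The drift towards the origin appears after symmetrising in the pair [(x, z)]:
   only the odd part of the swap probability survives. *)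
Lemma resample_mgf (delta c : R) s t : 0 <= delta <= 1 -> 0 < c ->
  (forall x z, `|s x - s z| <= c) ->
  (forall x, `|t x| <= 2^-1) -> \sum_x p x * t x = 0 ->
  \sum_x p x * (\sum_y resample p (swap_prob delta c s) x y * expR (t y)) <=
  expR (4 * (\sum_x p x * t x ^+ 2) - delta / c * (\sum_x p x * (s x * t x))).
Proof.
move=> /andP[d0 d1] c0 hs ht t0.
under eq_bigr do rewrite sum_resample mulrDr mulr_sumr.
rewrite big_split /=.
set Q := swap_prob delta c s.
set D := (X in _ + X).
pose g x := expR (t x).
(* The bound on the differences of [s] switches the clipping off, so the antisymmetric part of the
   probability is linear. *)
have qdiff x z : Q z x - Q x z = - (delta / c) * (s x - s z).
  rewrite /Q /swap_prob !clip_id.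
  - by field; rewrite gt_eqF.
  - by rewrite normrM normfV (gtr0_norm c0) ler_pdivrMr // mul1r.
  - by rewrite normrM normfV (gtr0_norm c0) ler_pdivrMr // mul1r.
have D2 : D + D = \sum_x \sum_z p x * p z * (- (delta / c) * (s x - s z) * (g x - g z)).
  rewrite {2}/D exchange_big /= /D -big_split /=; apply: eq_bigr => x _.
  rewrite -big_split /=; apply: eq_bigr => z _; rewrite -qdiff /g.
  ring.
(* Linearising exp costs 2 (t x ^ 2 + t z ^ 2), and this error is multiplied by a factor of size at
   most [delta]. *)
have Dle : D + D <= \sum_x \sum_z p x * p z *
    (- (delta / c) * (s x - s z) * (t x - t z) + 2 * delta * (t x ^+ 2 + t z ^+ 2)).
  rewrite D2; apply: ler_sum => x _; apply: ler_sum => z _.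
  apply: ler_wpM2l; first exact: mulr_ge0.
  have /andP[a1 a2] := expR_sub1_bound (ht x).
  have /andP[b1 b2] := expR_sub1_bound (ht z).
  have r1 : `|(g x - g z) - (t x - t z)| <= 2 * (t x ^+ 2 + t z ^+ 2).
    by rewrite ler_norml /g; apply/andP; split; nra.
  have r2 : `|delta / c * (s x - s z)| <= delta.
    rewrite normrM ger0_norm ?divr_ge0 ?(ltW c0) //.
    apply: (@le_trans _ _ (delta / c * c)); last by rewrite divfK ?gt_eqF.
    by rewrite ler_wpM2l ?divr_ge0 ?(ltW c0).
  have r3 : `|(delta / c * (s x - s z)) * ((g x - g z) - (t x - t z))| <=
      delta * (2 * (t x ^+ 2 + t z ^+ 2)) by rewrite normrM ler_pM.
  move: r3; rewrite ler_norml => /andP[r3 _].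
  set A := delta / c in r3 *; nra.
(* The mixed terms [s x * t z] vanish because [t] has mean zero. *)
have E2 : \sum_x \sum_z p x * p z *
    (- (delta / c) * (s x - s z) * (t x - t z) + 2 * delta * (t x ^+ 2 + t z ^+ 2)) =
    - (delta / c) * (2 * \sum_x p x * (s x * t x)) +
    4 * delta * \sum_x p x * t x ^+ 2.
  transitivity (\sum_x \sum_z
     (- (delta / c) * (p x * p z * (s x * t x)) +
     (- (delta / c) * (p x * p z * (s z * t z))) +
     (delta / c * (p x * p z * (s x * t z))) +
     (delta / c * (p x * p z * (t x * s z))) +
     (2 * delta * (p x * p z * (t x ^+ 2))) +
     (2 * delta * (p x * p z * (t z ^+ 2))))).
    by apply: eq_bigr => x _; apply: eq_bigr => z _; ring.
  under eq_bigr do rewrite !big_split /= -!mulr_sumr.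
  rewrite !big_split /= -!mulr_sumr.
  rewrite (sum_prod_law_fst (fun x => s x * t x)) (sum_prod_law_snd (fun x => s x * t x)).
  rewrite (sum_prod_law s t) (sum_prod_law t s) t0 mulr0 mul0r.
  rewrite (sum_prod_law_fst (fun x => t x ^+ 2)) (sum_prod_law_snd (fun x => t x ^+ 2)).
  ring.
have Eg : \sum_x p x * expR (t x) <= 1 + 2 * \sum_x p x * t x ^+ 2.
  have -> : 1 + 2 * (\sum_x p x * t x ^+ 2) =
      \sum_x p x * (1 + t x + 2 * t x ^+ 2).
    transitivity (\sum_x p x + \sum_x p x * t x + 2 * \sum_x p x * t x ^+ 2).
      by rewrite p_sum t0 addr0.
    rewrite mulr_sumr -!big_split /=.
    by apply: eq_bigr => x _; ring.
  by apply: ler_sum => x _; apply: ler_wpM2l => //; case/andP: (expR_sub1_bound (ht x)).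
(* With T the second moment of [t], the input contributes 2 T and the linearisation error 2 delta T
   <= 2 T; hence the constant 4. *)
apply: le_trans (expR_ge1Dx _).
rewrite E2 in Dle.
have T0 : 0 <= \sum_x p x * t x ^+ 2 by apply: sumr_ge0 => x _; rewrite mulr_ge0 ?sqr_ge0.
set A := delta / c in Dle *.
set T := \sum_x p x * t x ^+ 2 in Dle Eg T0 *.
set U := \sum_x p x * (s x * t x) in Dle *.
have : delta * T <= T by rewrite ler_piMl.
move: Dle Eg; nra.
Qed.

End law.
End self_balancing.

(** * Exponential moments of the walk *)

Section inner_product.
Context {R : realType} {V : finType}.
Implicit Types u w : V -> R.

Definition dot u w : R := \sum_v u v * w v.

Lemma dotC u w : dot u w = dot w u.
Proof. by apply: eq_bigr => v _; rewrite mulrC. Qed.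

Lemma dotDl u1 u2 w : dot (fun v => u1 v + u2 v) w = dot u1 w + dot u2 w.
Proof. by rewrite /dot -big_split /=; apply: eq_bigr => v _; rewrite mulrDl. Qed.

Lemma dotZl a u w : dot (fun v => a * u v) w = a * dot u w.
Proof. by rewrite /dot mulr_sumr; apply: eq_bigr => v _; rewrite mulrA. Qed.

Lemma dotBl u1 u2 w : dot (fun v => u1 v - u2 v) w = dot u1 w - dot u2 w.
Proof. by rewrite /dot -sumrB; apply: eq_bigr => v _; rewrite mulrBl. Qed.

Lemma dot_suml (I : finType) (a : I -> R) (u : I -> V -> R) w :
  dot (fun v => \sum_i a i * u i v) w = \sum_i a i * dot (u i) w.
Proof.
rewrite /dot.
under eq_bigr do rewrite mulr_suml.
rewrite exchange_big /=; apply: eq_bigr => i _; rewrite mulr_sumr.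
by apply: eq_bigr => v _; rewrite mulrA.
Qed.

Lemma dot_ge0 u : 0 <= dot u u.
Proof. by apply: sumr_ge0 => v _; rewrite -expr2 sqr_ge0. Qed.

(** Lagrange's identity: the sum of the squared 2 by 2 minors is twice the difference of the two
    sides. *)
Lemma dot_CauchySchwarz u w : dot u w ^+ 2 <= dot u u * dot w w.
Proof.
have : 0 <= \sum_v \sum_v' (u v * w v' - u v' * w v) ^+ 2.
  by apply: sumr_ge0 => v _; apply: sumr_ge0 => v' _; exact: sqr_ge0.
have E (f g : V -> R) : \sum_v \sum_v' f v * g v' = (\sum_v f v) * (\sum_v g v).
  by rewrite big_distrlr.
have -> : \sum_v \sum_v' (u v * w v' - u v' * w v) ^+ 2 =
    2 * (dot u u * dot w w) - 2 * dot u w ^+ 2; last by lra.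
transitivity (\sum_v \sum_v' ((u v * u v) * (w v' * w v') +
    (w v * w v) * (u v' * u v') + (- 2 * (u v * w v)) * (u v' * w v'))).
  by apply: eq_bigr => v _; apply: eq_bigr => v' _; ring.
under eq_bigr do rewrite !big_split /=.
by rewrite !big_split /= !E -mulr_sumr -!/(dot _ _); ring.
Qed.

End inner_product.

Section process.
Context {R : realType} {K V : finType}.
Variables (p : K -> R) (b : K -> V -> R) (delta c : R).

Definition centered (x : K) (v : V) : R := b x v - \sum_z p z * b z v.

Definition walk (ys : seq K) (v : V) : R := \sum_(y <- ys) centered y v.

Definition swap (ys : seq K) : K -> K -> R :=
  swap_prob delta c (fun x => dot (walk ys) (centered x)).

(* Paths are stored with the most recent step first. *)
Fixpoint path_kernel (xs ys : seq K) : R :=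
  match xs, ys with
  | x :: xs', y :: ys' => resample p (swap ys') x y * path_kernel xs' ys'
  | _, _ => 1
  end.

(** The last step is integrated first, conditionally on the past, which is the order in which the
    moment bounds are proved. *)
Fixpoint path_mean n (F : seq K -> seq K -> R) : R :=
  if n is n'.+1 then
    path_mean n' (fun xs ys => \sum_x p x *
      \sum_y resample p (swap ys) x y * F (x :: xs) (y :: ys))
  else F [::] [::].

Definition safe (ys : seq K) : bool :=
  [forall x, forall z,
    `|dot (walk ys) (centered x) - dot (walk ys) (centered z)| <= c].

(** The current position is exempt: the event guarantees that clipping was inactive in every step
    taken so far. *)
Fixpoint safe_past (ys : seq K) : bool :=
  if ys is _ :: ys' then safe ys' && safe_past ys' else true.

Lemma eq_path_mean n F G : (forall xs ys, F xs ys = G xs ys) ->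
  path_mean n F = path_mean n G.
Proof.
elim: n F G => [|n IH] F G FG /=; first exact: FG.
apply: IH => xs ys; apply: eq_bigr => x _; congr (_ * _).
by apply: eq_bigr => y _; rewrite FG.
Qed.

Lemma path_meanZ n a F :
  path_mean n (fun xs ys => a * F xs ys) = a * path_mean n F.
Proof.
elim: n F => [//|n IH] F /=; rewrite -IH; apply: eq_path_mean => xs ys.
rewrite mulr_sumr; apply: eq_bigr => x _; rewrite [RHS]mulrCA; congr (_ * _); rewrite mulr_sumr.
by apply: eq_bigr => y _; ring.
Qed.

Lemma path_meanD n F G :
  path_mean n (fun xs ys => F xs ys + G xs ys) = path_mean n F + path_mean n G.
Proof.
elim: n F G => [//|n IH] F G /=; rewrite -IH; apply: eq_path_mean => xs ys.
rewrite -big_split /=; apply: eq_bigr => x _.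
rewrite -mulrDr -big_split /=; congr (_ * _).
by apply: eq_bigr => y _; rewrite mulrDr.
Qed.

Lemma path_mean_sum n (I : Type) (r : seq I) (F : I -> seq K -> seq K -> R) :
  path_mean n (fun xs ys => \sum_(i <- r) F i xs ys) =
  \sum_(i <- r) path_mean n (F i).
Proof.
elim: r => [|i r IH].
  rewrite big_nil -[RHS](mul0r (path_mean n (fun _ _ => 0))) -path_meanZ.
  by apply: eq_path_mean => xs ys; rewrite big_nil mul0r.
rewrite big_cons -IH -path_meanD; apply: eq_path_mean => xs ys.
by rewrite big_cons.
Qed.

Hypotheses (p_ge0 : forall x, 0 <= p x) (p_sum : \sum_x p x = 1).
Hypotheses (delta_itv : 0 < delta <= 1) (c_gt0 : 0 < c).

Lemma path_step_ge0 ys x y : 0 <= resample p (swap ys) x y.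
Proof.
apply: resample_ge0 => // x' z; case/andP: delta_itv => d0 d1.
have /andP[-> /= h] := swap_prob_itv c
  (fun x => dot (walk ys) (centered x)) x' z (ltW d0).
exact: le_trans d1.
Qed.

Lemma path_kernel_ge0 xs ys : 0 <= path_kernel xs ys.
Proof.
elim: xs ys => [|x xs IH] [|y ys] //=.
by rewrite mulr_ge0 // path_step_ge0.
Qed.

Lemma le_path_mean n F G :
  (forall xs ys, size xs = n -> size ys = n -> F xs ys <= G xs ys) ->
  path_mean n F <= path_mean n G.
Proof.
elim: n F G => [|n IH] F G FG /=; first exact: FG.
apply: IH => xs ys sx sy; apply: ler_sum => x _; apply: ler_wpM2l => //.
apply: ler_sum => y _; apply: ler_wpM2l; first exact: path_step_ge0.
by apply: FG; rewrite /= ?sx ?sy.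
Qed.

Lemma path_mean_cst n a : path_mean n (fun _ _ => a) = a.
Proof.
rewrite -[RHS]mulr1 -[in LHS](mulr1 a) path_meanZ; congr (_ * _).
elim: n => [//|n IH] /=; rewrite -[RHS]IH; apply: eq_path_mean => xs ys.
under eq_bigr => x _.
  under eq_bigr do rewrite mulr1.
  rewrite sum_resample1 mulr1; over.
exact: p_sum.
Qed.

Lemma centered_mean (u : V -> R) : \sum_x p x * dot u (centered x) = 0.
Proof.
transitivity (dot (fun v => \sum_x p x * centered x v) u).
  by rewrite dot_suml; apply: eq_bigr => x _; rewrite dotC.
rewrite /dot big1 // => v _.
under eq_bigr do rewrite /centered mulrBr.
by rewrite sumrB -mulr_suml p_sum mul1r subrr mul0r.
Qed.

Variable W : R.
Hypothesis b_gram : forall x z, 0 <= dot (b x) (b z) <= W.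

(** The expansion has four terms in [0, W], two of each sign, because averaging over [p] preserves
    [0, W]. *)
Lemma centered_gram x z : `|dot (centered x) (centered z)| <= 2 * W.
Proof.
pose beta v := \sum_z p z * b z v.
have avg (f : K -> R) : (forall x, 0 <= f x <= W) -> 0 <= \sum_x p x * f x <= W.
  move=> fW; apply/andP; split.
    by apply: sumr_ge0 => y _; rewrite mulr_ge0 //; case/andP: (fW y).
  rewrite -[leRHS]mul1r -p_sum mulr_suml; apply: ler_sum => y _.
  by rewrite ler_wpM2l //; case/andP: (fW y).
have bb u : 0 <= dot (b u) beta <= W.
  by rewrite dotC dot_suml; apply: avg => y; exact: b_gram.
have BB : 0 <= dot beta beta <= W.
  by rewrite {1 3}/beta !dot_suml; apply: avg => y; exact: bb.
have -> : dot (centered x) (centered z) =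
    dot (b x) (b z) - dot (b x) beta - dot (b z) beta + dot beta beta.
  have split_l y u : dot (centered y) u = dot (b y) u - dot beta u by exact: dotBl.
  rewrite split_l [dot (b x) (centered z)]dotC [dot beta (centered z)]dotC !split_l.
  by rewrite (dotC (b z) (b x)) (dotC beta (b x)); ring.
move: (b_gram x z) (bb x) (bb z) BB => /andP[? ?] /andP[? ?] /andP[? ?] /andP[? ?].
by rewrite ler_norml; apply/andP; split; lra.
Qed.

(** The means cancel, and the cross term is nonpositive since the Gram entries are nonnegative. *)
Lemma centered_diff_norm x z :
  dot (fun v => centered x v - centered z v) (fun v => centered x v - centered z v)
  <= 2 * W.
Proof.
have -> : (fun v => centered x v - centered z v) = (fun v => b x v - b z v).
  by apply/funext => v; rewrite /centered; ring.
rewrite dotBl [dot (b x) _]dotC [dot (b z) _]dotC !dotBl (dotC (b z) (b x)).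
move: (b_gram x z) (b_gram x x) (b_gram z z) => /andP[? ?] /andP[? ?] /andP[? ?].
lra.
Qed.

(** The covariance of the vectors [centered x] under [p] has norm at most 2 W, so a drift of
    strength delta / c does not overshoot. *)
Hypothesis c_large : 2 * W * (delta / c) <= 1.

(* The drift is linear in the walk with the covariance operator of the steps,
   so it contracts the exponent: [theta] becomes [theta - (delta / c) u], where
   [u] is the image of [theta] under that covariance.  The resulting decrease of
   [dot theta theta] pays for the second order term of the step. *)
Lemma path_mgf n (theta : V -> R) : 8 * W * dot theta theta <= 1 ->
  path_mean n (fun _ ys => (safe_past ys)%:R * expR (dot theta (walk ys))) <=
  expR (4 * (c / delta) * dot theta theta).
Proof.
case/andP: delta_itv => d0 d1.
elim: n theta => [|n IH] theta small.
  rewrite /= mul1r ler_expR {1}/dot big1 => [|v _]; last first.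
    by rewrite /walk big_nil mulr0.
  by rewrite mulr_ge0 ?dot_ge0 // mulr_ge0 // divr_ge0 // ltW.
set a := delta / c.
have a0 : 0 < a by rewrite divr_gt0.
pose t x := dot theta (centered x).
pose T := \sum_x p x * t x ^+ 2.
have T0 : 0 <= T by apply: sumr_ge0 => x _; rewrite mulr_ge0 ?sqr_ge0.
pose u v := \sum_x p x * t x * centered x v.
pose theta' v := theta v - a * u v.
have th : dot theta u = T.
  rewrite dotC dot_suml; apply: eq_bigr => x _.
  by rewrite [dot (centered x) theta]dotC -/(t x); ring.
(* Combine 2 |t x * t z| <= t x ^ 2 + t z ^ 2 with the Gram bound 2 W. *)
have uu : dot u u <= 2 * W * T.
  rewrite dot_suml.
  apply: (@le_trans _ _ (\sum_x \sum_z p x * p z * (W * (t x ^+ 2 + t z ^+ 2)))).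
    apply: ler_sum => x _; rewrite dotC dot_suml mulr_sumr.
    apply: ler_sum => z _.
    rewrite (_ : _ * _ = p x * p z * (t x * t z * dot (centered z) (centered x)));
      last by ring.
    apply: ler_wpM2l; first exact: mulr_ge0.
    apply: le_trans (ler_norm _) _; rewrite normrM.
    apply: le_trans (ler_wpM2l (normr_ge0 _) (centered_gram z x)) _.
    have W0 : 0 <= W by case/andP: (b_gram x x) => ? ?; lra.
    have tt : 2 * `|t x * t z| <= t x ^+ 2 + t z ^+ 2.
      rewrite normrM -[t x ^+ 2]real_normK ?num_real // -[t z ^+ 2]real_normK ?num_real //.
      have := sqr_ge0 (`|t x| - `|t z|); lra.
    nra.
  under eq_bigr => x _.
    under eq_bigr => z _.
      rewrite (_ : _ * _ = p x * p z * (W * t x ^+ 2) + p x * p z * (W * t z ^+ 2));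
        last by ring.
      over.
    rewrite big_split /=; over.
  rewrite big_split /= (sum_prod_law_fst p_sum (fun x => W * t x ^+ 2)).
  rewrite (sum_prod_law_snd p_sum (fun x => W * t x ^+ 2)).
  rewrite (_ : \sum_x p x * (W * t x ^+ 2) = W * T); first by lra.
  by rewrite mulr_sumr; apply: eq_bigr => x _; ring.
(* Half of the gain 2 a T pays for the second order term a^2 |u|^2, by the condition on [c]. *)
have nth' : dot theta' theta' <= dot theta theta - a * T.
  have -> : dot theta' theta' = dot theta theta - 2 * a * T + a ^+ 2 * dot u u.
    have split_l w : dot theta' w = dot theta w - a * dot u w.
      by rewrite /theta' dotBl dotZl.
    rewrite split_l [dot theta theta']dotC [dot u theta']dotC !split_l.
    by rewrite (dotC u theta) th; ring.
  have : a ^+ 2 * dot u u <= a * T.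
    rewrite expr2 -mulrA ler_pM2l //.
    apply: le_trans (ler_wpM2l (ltW a0) uu) _.
    by rewrite mulrA (mulrC a) ler_piMl.
  lra.
(* Cauchy-Schwarz with |centered x|^2 <= 2 W gives (t x)^2 <= 1/4; this is the origin of the 8 in
   the smallness condition. *)
have small_t x : `|t x| <= 2^-1.
  have W0' : 0 <= W by case/andP: (b_gram x x) => ? ?; lra.
  rewrite -(ler_pXn2r (ltn0Sn 1)) ?nnegrE ?invr_ge0 // real_normK ?num_real //.
  apply: le_trans (dot_CauchySchwarz _ _) _.
  have := le_trans (ler_norm _) (centered_gram x x).
  move=> /(ler_wpM2l (dot_ge0 theta)) h; apply: le_trans h _; lra.
have small' : 8 * W * dot theta' theta' <= 1.
  have [W0'|] := leP 0 W; last by have := dot_ge0 theta'; nra.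
  apply: le_trans small; rewrite ler_wpM2l ?mulr_ge0 //.
  by apply: le_trans nth' _; rewrite gerBl mulr_ge0 // ltW.
apply: (@le_trans _ _ (path_mean n (fun _ ys => expR (4 * T) *
    ((safe_past ys)%:R * expR (dot theta' (walk ys)))))).
  rewrite [leLHS]/=; apply: le_path_mean => xs ys _ _.
  have [sf|nsf] /= := boolP (safe ys); last first.
    rewrite big1 ?mulr_ge0 ?expR_ge0 // => x _; rewrite big1 ?mulr0 // => y _.
    by rewrite mul0r mulr0.
  set s := fun x => dot (walk ys) (centered x).
  have walk_cons y : dot theta (walk (y :: ys)) = t y + dot theta (walk ys).
    rewrite [LHS]dotC /t [dot theta (centered y)]dotC [dot theta (walk ys)]dotC -dotDl.
    by congr dot; apply/funext => v; rewrite /walk big_cons.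
  have -> : \sum_x p x * (\sum_y resample p (swap ys) x y *
        ((safe_past ys)%:R * expR (dot theta (walk (y :: ys))))) =
      (safe_past ys)%:R * expR (dot theta (walk ys)) *
      \sum_x p x * (\sum_y resample p (swap ys) x y * expR (t y)).
    rewrite mulr_sumr; apply: eq_bigr => x _.
    rewrite [RHS]mulrCA; congr (_ * _); rewrite mulr_sumr; apply: eq_bigr => y _.
    by rewrite walk_cons expRD; ring.
  rewrite mulrCA -mulrA ler_wpM2l //.
  have hs x z : `|s x - s z| <= c by move/forallP: sf => /(_ x) /forallP /(_ z).
  have dd : 0 <= delta <= 1 by rewrite ltW.
  (* Since [s] is linear in the walk, the drift term is - a times the pairing of [u] with the walk,
     which turns [theta] into [theta']. *)
  have := resample_mgf p_ge0 p_sum dd c_gt0 hs small_t (centered_mean theta).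
  move=> /(ler_wpM2l (expR_ge0 (dot theta (walk ys)))) h; apply: le_trans h _.
  rewrite -!expRD ler_expR -/T /theta' dotBl dotZl dot_suml -/a.
  rewrite (_ : \sum_x p x * (s x * t x) =
      \sum_x p x * t x * dot (centered x) (walk ys)); first by lra.
  by apply: eq_bigr => x _; rewrite /s [dot (walk ys) _]dotC; ring.
rewrite path_meanZ.
apply: le_trans (ler_wpM2l (expR_ge0 _) (IH _ small')) _.
rewrite -expRD ler_expR.
(* The cost 4 T of the step is cancelled exactly: 4 (c / delta) a T = 4 T. *)
have a1 : c / delta = a^-1 by rewrite invf_div.
rewrite a1; have : a^-1 * dot theta' theta' <= a^-1 * dot theta theta - T.
  rewrite -[X in _ - X](mulKf (lt0r_neq0 a0) T) -mulrBr ler_wpM2l //.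
  by rewrite invr_ge0 ltW.
lra.
Qed.

Lemma path_tail n (u : V -> R) (W_gt0 : 0 < W) : dot u u <= 2 * W ->
  path_mean n (fun _ ys => (safe_past ys && (c < dot u (walk ys)))%:R) <=
  expR (- (delta * c / (32 * W))).
Proof.
move=> uW; case/andP: delta_itv => d0 d1.
(* The Chernoff parameter minimising - lam c + 8 (c / delta) W lam^2; the minimum is - delta c / (32
   W). *)
pose lam := delta / (16 * W).
have lam0 : 0 < lam by rewrite divr_gt0 ?mulr_gt0.
have nl : dot (fun v => lam * u v) (fun v => lam * u v) = lam ^+ 2 * dot u u.
  by rewrite dotZl dotC dotZl; ring.
have lamW : lam * W = delta / 16 by rewrite /lam; field; rewrite gt_eqF.
have small : 8 * W * dot (fun v => lam * u v) (fun v => lam * u v) <= 1.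
  rewrite nl; apply: (@le_trans _ _ (8 * W * (lam ^+ 2 * (2 * W)))).
    by rewrite !ler_wpM2l ?sqr_ge0 ?mulr_ge0 // ltW.
  rewrite (_ : _ * _ = 16 * (lam * W) ^+ 2); last by ring.
  rewrite lamW; nra.
apply: (@le_trans _ _ (path_mean n (fun _ ys => expR (- (lam * c)) *
   ((safe_past ys)%:R * expR (dot (fun v => lam * u v) (walk ys)))))).
  apply: le_path_mean => xs ys _ _.
  have [_|_] /= := boolP (safe_past ys); last by rewrite mul0r mulr0.
  rewrite mul1r -expRD; case: (ltP c (dot u (walk ys))) => h; last exact: expR_ge0.
  by rewrite -[leLHS]expR0 ler_expR dotZl; nra.
rewrite path_meanZ.
apply: le_trans (ler_wpM2l (expR_ge0 _) (path_mgf n small)) _.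
rewrite -expRD ler_expR nl.
have : c / delta * (lam ^+ 2 * dot u u) <= c / delta * (lam ^+ 2 * (2 * W)).
  by apply: ler_wpM2l; [rewrite divr_ge0 // ltW | apply: ler_wpM2l; rewrite ?sqr_ge0].
have -> : c / delta * (lam ^+ 2 * (2 * W)) = delta * c / W / 128.
  by rewrite /lam; field; rewrite !gt_eqF.
have -> : lam * c = delta * c / W / 16 by rewrite /lam; field; rewrite gt_eqF.
have -> : delta * c / (32 * W) = delta * c / W / 32 by field; rewrite gt_eqF.
lra.
Qed.

(** Union bound over the first exit from safety and the pairs of states: at that time the past is
    still safe, so [path_tail] applies without circularity. *)
Lemma path_unsafe n (W_gt0 : 0 < W) :
  path_mean n (fun _ ys => (~~ safe_past ys)%:R) <=
  n%:R * (#|K| ^ 2)%:R * expR (- (delta * c / (32 * W))).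
Proof.
set eps := expR _.
elim: n => [|n IH]; first by rewrite /= !mul0r.
apply: (@le_trans _ _ (path_mean n (fun _ ys => (~~ safe_past ys)%:R +
   \sum_x \sum_z (safe_past ys &&
      (c < dot (fun v => centered x v - centered z v) (walk ys)))%:R))).
  rewrite [leLHS]/=; apply: le_path_mean => xs ys _ _.
  under eq_bigr do rewrite -mulr_suml (sum_resample1 p _ _) mul1r.
  rewrite -mulr_suml p_sum mul1r negb_and.
  have [ok|_] /= := boolP (safe_past ys); last first.
    by rewrite orbT lerDl sumr_ge0 // => x _; rewrite sumr_ge0.
  rewrite orbF add0r.
  have [//|] := boolP (safe ys); first by rewrite sumr_ge0 // => x _; rewrite sumr_ge0.
  case/forallPn => x /forallPn[z]; rewrite -ltNge /= => h.
  (* A large negative difference is a large positive one for the exchanged pair. *)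
  have [x' [z' h']] : exists x' z',
      c < dot (fun v => centered x' v - centered z' v) (walk ys).
    move: h; rewrite lter_normr => /orP[h|h].
      by exists x, z; rewrite dotBl -!(dotC (walk ys)).
    by exists z, x; rewrite dotBl -!(dotC (walk ys)); move: h; rewrite opprB.
  rewrite (bigD1 x') //= (bigD1 z') //= h' -addrA lerDl addr_ge0 //.
    by rewrite sumr_ge0.
  by rewrite sumr_ge0 // => ? _; rewrite sumr_ge0.
rewrite path_meanD -natr1 !mulrDl mul1r lerD //.
rewrite path_mean_sum.
apply: (@le_trans _ _ (\sum_(x : K) \sum_(z : K) eps)).
  apply: ler_sum => x _; rewrite path_mean_sum; apply: ler_sum => z _.
  exact/path_tail/centered_diff_norm.
by rewrite !sumr_const -mulrnA mulnn mulr_natl.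
Qed.

(** Union bound over an unsafe past and the one-sided deviations along each [a i] and its
    opposite. *)
Lemma path_deviation n (W_gt0 : 0 < W) (I : finType) (a : I -> V -> R) :
  (forall i, dot (a i) (a i) <= W) ->
  path_mean n (fun _ ys => [exists i, c < `|dot (a i) (walk ys)|]%:R) <=
  (n * #|K| ^ 2 + 2 * #|I|)%:R * expR (- (delta * c / (32 * W))).
Proof.
move=> aW; set eps := expR _.
apply: (@le_trans _ _ (path_mean n (fun _ ys => (~~ safe_past ys)%:R +
   \sum_i ((safe_past ys && (c < dot (a i) (walk ys)))%:R +
            (safe_past ys && (c < dot (fun v => -1 * a i v) (walk ys)))%:R)))).
  apply: le_path_mean => xs ys _ _ /=.
  have [ok|_] /= := boolP (safe_past ys); last first.
    apply: (@le_trans _ _ 1); first by rewrite lern1 leq_b1.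
    by rewrite lerDl sumr_ge0 // => i _; rewrite addr_ge0.
  rewrite add0r.
  have [|_] := boolP [exists i, c < `|dot (a i) (walk ys)|]; last first.
    by rewrite sumr_ge0 // => i _; rewrite addr_ge0.
  case/existsP => i; rewrite lter_normr => h.
  rewrite (bigD1 i) //= dotZl mulN1r.
  apply: ler_wpDr; first by rewrite sumr_ge0 // => ? _; rewrite addr_ge0.
  by case/orP: h => -> /=; rewrite ?lerDl ?lerDr ler0n.
rewrite path_meanD natrD mulrDl natrM lerD //; first exact: path_unsafe.
rewrite path_mean_sum.
apply: (@le_trans _ _ (\sum_(i : I) (eps + eps))).
  apply: ler_sum => i _; rewrite path_meanD lerD //; apply: path_tail => //.
    by apply: le_trans (aW i) _; lra.
  by rewrite dotZl dotC dotZl; apply: le_trans (_ : _ <= dot (a i) (a i)) _;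
    [lra | apply: le_trans (aW i) _; lra].
rewrite sumr_const -[_ *+ _]mulr_natl natrM; lra.
Qed.

(** Each step moves with conditional probability at most [delta], clipped or not. *)
Lemma path_changes n :
  path_mean n (fun xs ys => (count (fun z => z.1 != z.2) (zip xs ys))%:R) <=
  n%:R * delta.
Proof.
case/andP: delta_itv => d0 d1.
elim: n => [|n IH]; first by rewrite /= mul0r.
apply: (@le_trans _ _ (path_mean n (fun xs ys =>
    (count (fun z => z.1 != z.2) (zip xs ys))%:R + delta))); last first.
  by rewrite path_meanD path_mean_cst -natr1 mulrDl mul1r lerD2r.
rewrite [leLHS]/=; apply: le_path_mean => xs ys _ _.
set N := count _ _.
have step x : \sum_y resample p (swap ys) x y * ((x != y) + N)%:R <= N%:R + delta.
  rewrite sum_resample eqxx add0n lerD2l.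
  apply: (@le_trans _ _ (\sum_z p z * delta)); last by rewrite -mulr_suml p_sum mul1r.
  apply: ler_sum => z _; rewrite natrD addrK -mulrA ler_wpM2l //.
  have /andP[h1 h2] := swap_prob_itv c
    (fun x => dot (walk ys) (centered x)) x z (ltW d0).
  by apply: le_trans h2; rewrite ler_piMr // lern1 leq_b1.
apply: (@le_trans _ _ (\sum_x p x * (N%:R + delta))).
  by apply: ler_sum => x _; rewrite ler_wpM2l.
by rewrite -mulr_suml p_sum mul1r.
Qed.

End process.

(** * Paths as couplings of tuples *)

Lemma sum_tuple0 (R : realType) (K : finType) (G : 0.-tuple K -> R) :
  \sum_t G t = G [tuple].
Proof. by apply: big_pred1 => t /=; apply/esym/eqP; exact: tuple0. Qed.

Lemma sum_tuple_cons (R : realType) (K : finType) n (G : n.+1.-tuple K -> R) :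
  \sum_t G t = \sum_(t : n.-tuple K) \sum_x G [tuple of x :: t].
Proof.
rewrite pair_big /=.
rewrite (reindex (fun z : n.-tuple K * K => [tuple of z.2 :: z.1])) //=.
exists (fun t : n.+1.-tuple K => ([tuple of behead t], thead t)) => [[t x] _|t _] /=.
  by congr (_, _); exact/val_inj.
by rewrite [RHS]tuple_eta; exact/val_inj.
Qed.

(** The inputs are independent of law [p], and the outputs follow the kernel [k] given all the
    inputs. *)
Definition coupling_mean (R : realType) (K : finType) n (p : K -> R)
    (k : n.-tuple K -> n.-tuple K -> R) (F : n.-tuple K -> n.-tuple K -> R) : R :=
  \sum_(xs : n.-tuple K) \sum_(ys : n.-tuple K) (\prod_(x <- xs) p x) * k xs ys * F xs ys.

Section path_coupling.
Context {R : realType} {K V : finType}.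
Variables (p : K -> R) (b : K -> V -> R) (delta c : R).

Let k n (xs ys : n.-tuple K) : R := path_kernel p b delta c xs ys.

(** As the head of a path is its latest step, the tuple is processed from its last entry to its
    first. *)
Lemma path_meanE n F : path_mean p b delta c n F =
  coupling_mean p (@k n) (fun xs ys => F xs ys).
Proof.
rewrite /coupling_mean; elim: n F => [|n IH] F.
  by rewrite !sum_tuple0 /= big_nil !mul1r.
rewrite /= IH sum_tuple_cons; apply: eq_bigr => xs _.
under [RHS]eq_bigr do rewrite sum_tuple_cons.
rewrite exchange_big /=; apply: eq_bigr => ys _.
rewrite mulr_sumr; apply: eq_bigr => x _.
rewrite mulrA mulr_sumr; apply: eq_bigr => y _.
rewrite big_cons /k /=; ring.
Qed.

Hypotheses (p_ge0 : forall x, 0 <= p x) (p_sum : \sum_x p x = 1).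

Lemma sum_path_kernel n (xs : n.-tuple K) : \sum_ys k xs ys = 1.
Proof.
rewrite /k; elim: n xs => [|n IH] xs.
  by rewrite sum_tuple0 /=; case: (tval xs).
case/tupleP: xs => x xs.
rewrite sum_tuple_cons -[RHS](IH xs); apply: eq_bigr => ys _ /=.
by rewrite -mulr_suml (sum_resample1 p _ _) mul1r.
Qed.

Hypotheses (delta_itv : 0 < delta <= 1) (c_gt0 : 0 < c).
Variable W : R.
Hypotheses (W_gt0 : 0 < W) (b_gram : forall x z, 0 <= dot (b x) (b z) <= W).
Hypothesis c_large : 2 * W * (delta / c) <= 1.

(** The walk disappears from the interface: its pairing with [a i] is a centered sum, over the
    outputs, of pairings of [a i] with [b]. *)
Lemma balanced_coupling n (I : finType) (a : I -> V -> R) :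
  (forall i, dot (a i) (a i) <= W) ->
  exists k : n.-tuple K -> n.-tuple K -> R,
  [/\ forall xs ys, 0 <= k xs ys,
      forall xs, \sum_ys k xs ys = 1,
      coupling_mean p k (fun xs ys => (num_changed xs ys)%:R) <= n%:R * delta &
      coupling_mean p k (fun _ ys => [exists i, c <
        `|\sum_(y <- ys) (dot (a i) (b y) - \sum_x p x * dot (a i) (b x))|]%:R) <=
      (n * #|K| ^ 2 + 2 * #|I|)%:R * expR (- (delta * c / (32 * W)))].
Proof.
move=> aW; exists (@k n); split.
- by move=> xs ys; exact: path_kernel_ge0.
- exact: sum_path_kernel.
- apply: le_trans (path_changes b c p_ge0 p_sum delta_itv n).
  rewrite path_meanE /coupling_mean le_eqVlt; apply/orP; left; apply/eqP.
  apply: eq_bigr => xs _; apply: eq_bigr => ys _; congr (_ * _%:R).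
  rewrite /num_changed -sum1_card -sum1_count (big_tuple _ _ [tuple of zip xs ys]).
  apply: eq_bigl => i; rewrite (tnth_nth (tnth xs i, tnth ys i)) /=.
  by rewrite nth_zip ?size_tuple //= -!tnth_nth inE eq_sym.
- apply: le_trans (path_deviation p_ge0 p_sum delta_itv c_gt0 b_gram c_large n W_gt0 aW).
  rewrite path_meanE /coupling_mean le_eqVlt; apply/orP; left; apply/eqP.
  apply: eq_bigr => xs _; apply: eq_bigr => ys _; congr (_ * _%:R).
  congr nat_of_bool; apply: eq_existsb => i; congr (_ < `|_|).
  rewrite dotC /walk.
  transitivity (\sum_(y <- ys) dot (centered p b y) (a i)).
    apply: eq_bigr => y _; rewrite /centered dotBl [dot (b y) _]dotC; congr (_ - _).
    by rewrite dot_suml; apply: eq_bigr => x _; rewrite dotC.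
  rewrite /dot exchange_big /=; apply: eq_bigr => v _.
  by rewrite mulr_suml.
Qed.

End path_coupling.

(** * Dyadic boxes *)

Section dyadic.
Context {R : realType}.
Variables J M : nat.

(** The index [v = (l, i)] stands for the interval [i 2^l, (i + 1) 2^l). *)
Definition dyadic_cell (x : nat) (v : 'I_J * 'I_M) : R :=
  (x %/ 2 ^ v.1 == v.2)%N%:R.

(* The dyadic intervals composing [0, a) are the left siblings of the dyadic
   intervals containing [a] that are right children. *)
Definition dyadic_cut (a : nat) (v : 'I_J * 'I_M) : R :=
  (odd (a %/ 2 ^ v.1) && (a %/ 2 ^ v.1 == v.2.+1))%N%:R.

(** Induction on the bits: x < a means that the halves, rounded down, satisfy it, or that they agree
    with [a] odd and [x] even, which is the level 0 term. *)
Lemma sum_left_siblings a x : (a < 2 ^ J)%N ->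
  (\sum_(l < J) (odd (a %/ 2 ^ l) && (a %/ 2 ^ l == (x %/ 2 ^ l).+1)))%N = (x < a)%N.
Proof.
elim: J a x => [|j IH] a x aJ; first by rewrite big_ord0; lia.
rewrite big_ord_recl /= expn0 !divn1.
under eq_bigr do rewrite /bump /= add1n expnS !divnMA.
rewrite IH; last by move: aJ; rewrite expnS; lia.
have := odd_double_half a; have := odd_double_half x.
rewrite !divn2 -!mul2n; case: (odd a); case: (odd x) => /=; lia.
Qed.

Lemma sum_dyadic_cell_cut a x : (a < 2 ^ J)%N -> (x < M)%N ->
  \sum_v dyadic_cut a v * dyadic_cell x v = (x < a)%N%:R.
Proof.
move=> aJ xM; rewrite -(sum_left_siblings x aJ) natr_sum.
rewrite -(pair_bigA _ (fun l v => dyadic_cut a (l, v) * dyadic_cell x (l, v))) /=.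
apply: eq_bigr => l _.
have xl : (x %/ 2 ^ l < M)%N by apply: leq_ltn_trans xM; exact: leq_div.
rewrite (bigD1 (Ordinal xl)) //= big1 ?addr0 => [|v vx].
  by rewrite /dyadic_cut /dyadic_cell /= eqxx mulr1.
rewrite /dyadic_cell /= (_ : (_ == _) = false) ?mulr0 //.
by apply: contra_neqF vx => /eqP e; exact/val_inj.
Qed.

(** Each of the J levels contributes at most one index. *)
Lemma sum_level_unique (P : 'I_J -> 'I_M -> bool) :
  (forall l v v', P l v -> P l v' -> v = v') ->
  0 <= (\sum_v (P v.1 v.2)%:R : R) <= J%:R.
Proof.
move=> Pu; rewrite sumr_ge0 //=.
rewrite -(pair_bigA _ (fun l v => (P l v)%:R : R)) /=.
apply: (@le_trans _ _ (\sum_(l < J) 1)); last by rewrite sumr_const card_ord.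
apply: ler_sum => l _; rewrite -natr_sum -[leRHS]/(1%:R) ler_nat -big_mkcond sum1_card.
by apply/card_le1P => v Pv v'; rewrite inE; apply/idP/eqP => [/(Pu l v)->|->].
Qed.

Lemma dyadic_cell_gram x z :
  0 <= \sum_v dyadic_cell x v * dyadic_cell z v <= J%:R.
Proof.
under eq_bigr do rewrite -natrM mulnb.
apply: (@sum_level_unique (fun l v => (x %/ 2 ^ l == v) && (z %/ 2 ^ l == v))%N).
by move=> l v v' /andP[/eqP e _] /andP[/eqP e' _]; apply/val_inj; rewrite /= -e -e'.
Qed.

Lemma dyadic_cut_norm a : 0 <= \sum_v dyadic_cut a v * dyadic_cut a v <= J%:R.
Proof.
under eq_bigr do rewrite -natrM mulnb andbb.
apply: (@sum_level_unique (fun l v => odd (a %/ 2 ^ l) && (a %/ 2 ^ l == v.+1))%N).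
by move=> l v v' /andP[_ /eqP e] /andP[_ /eqP e']; apply/val_inj; move: e'; rewrite e => -[].
Qed.

End dyadic.

Section dyadic_boxes.
Context {R : realType}.
Variables d J M : nat.

Definition box_cell (x : 'I_d -> nat) (f : {ffun 'I_d -> 'I_J * 'I_M}) : R :=
  \prod_i dyadic_cell (x i) (f i).

Definition box_cut (a : 'I_d -> nat) (f : {ffun 'I_d -> 'I_J * 'I_M}) : R :=
  \prod_i dyadic_cut (a i) (f i).

(** Distributivity: inner products of product vectors factorise, so the estimates on one axis
    multiply. *)
Lemma dot_prod (F G : 'I_d -> 'I_J * 'I_M -> R) :
  dot (fun f : {ffun 'I_d -> 'I_J * 'I_M} => \prod_i F i (f i))
      (fun f => \prod_i G i (f i)) = \prod_i \sum_v F i v * G i v.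
Proof.
by rewrite bigA_distr_bigA /=; apply: eq_bigr => f _; rewrite -big_split.
Qed.

Lemma dot_box_cut_cell a x : (forall i, (a i < 2 ^ J)%N) -> (forall i, (x i < M)%N) ->
  dot (box_cut a) (box_cell x) = [forall i, (x i < a i)%N]%:R.
Proof.
move=> aJ xM; rewrite (dot_prod (fun i => dyadic_cut (a i)) (fun i => dyadic_cell (x i))).
under eq_bigr do rewrite sum_dyadic_cell_cut //.
have [/forallP xa|/forallPn[i xa]] := boolP [forall i, (x i < a i)%N].
  by rewrite big1 // => i _; rewrite xa.
by rewrite (bigD1 i) //= (negPf xa) mul0r.
Qed.

Let prod_itv (F : 'I_d -> R) : (forall i, 0 <= F i <= J%:R) ->
  0 <= \prod_i F i <= (J ^ d)%:R.
Proof.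
move=> FJ; rewrite prodr_ge0 => [/=|i _]; last by case/andP: (FJ i).
apply: le_trans (_ : \prod_(i < d) J%:R <= _); first exact: ler_prod.
by rewrite prodr_const card_ord natrX.
Qed.

Lemma box_cell_gram x z : 0 <= dot (box_cell x) (box_cell z) <= (J ^ d)%:R.
Proof.
rewrite (dot_prod (fun i => dyadic_cell (x i)) (fun i => dyadic_cell (z i))).
by apply: prod_itv => i; exact: dyadic_cell_gram.
Qed.

Lemma box_cut_norm a : dot (box_cut a) (box_cut a) <= (J ^ d)%:R.
Proof.
rewrite (dot_prod (fun i => dyadic_cut (a i)) (fun i => dyadic_cut (a i))).
by have /andP[] := prod_itv (fun i => dyadic_cut_norm J M (a i)).
Qed.

End dyadic_boxes.

(** * Cells of small mass *)

Section quantile_cells.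
Context {R : realType}.

(** If [I] has no maximum, each of its points lies below a rational that lies below another point of
    [I]; running maxima of points chosen above the rationals are then cofinal. *)
Lemma cofinal_sequence (I : set R) : I !=set0 -> exists h : nat -> R,
  [/\ forall n, I (h n), {homo h : m n / (m <= n)%N >-> m <= n} &
      forall x, I x -> exists n, x <= h n].
Proof.
case=> x0 Ix0.
have [[m Im mmax]|nomax] := pselect (exists2 m, I m & forall x, I x -> x <= m).
  by exists (fun=> m); split=> // x Ix; exists 0%N; exact: mmax.
pose above (n : nat) : set R :=
  if @unpickle rat n is Some q then [set x | I x /\ ratr q <= x] else set0.
pose u n := if pselect (exists x, above n x) is left e then projT1 (cid e) else x0.
have Iu n : I (u n).
  rewrite /u; case: pselect => // e; case: (cid e) => /= x.
  by rewrite /above; case: unpickle => // q [].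
have u_cofinal x : I x -> exists n, x <= u n.
  move=> Ix; have [y Iy xy] : exists2 y, I y & x < y.
    apply: contrapT => h; apply: nomax; exists x => // y Iy.
    by rewrite leNgt; apply/negP => xy; apply: h; exists y.
  have [q] := rat_in_itvoo xy; rewrite in_itv /= => /andP[xq qy].
  exists (pickle q); rewrite /u; case: pselect => [e|[]]; last first.
    by exists y; rewrite /above pickleK; split=> //; exact: ltW.
  case: (cid e) => z /=; rewrite /above pickleK => -[_ qz].
  exact/ltW/(lt_le_trans xq).
pose h := fix h n := if n is n'.+1 then Num.max (h n') (u n) else u 0%N.
exists h; split.
- by elim=> [|n IH] //=; rewrite /Num.max; case: ifP.
- apply: homo_leq => [//|x y z|n] /=; first exact: le_trans.
  by rewrite le_max lexx.
- move=> x /u_cofinal[n xn]; exists n; apply: le_trans xn _.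
  by case: n => [|n] //=; rewrite le_max lexx orbT.
Qed.

Lemma coinitial_sequence (I : set R) : I !=set0 -> exists h : nat -> R,
  [/\ forall n, I (h n), {homo h : m n / (m <= n)%N >-> n <= m} &
      forall x, I x -> exists n, h n <= x].
Proof.
case=> x0 Ix0.
have [|h [Ih hmono hcof]] := @cofinal_sequence [set x | I (- x)].
  by exists (- x0); rewrite /= opprK.
exists (fun n => - h n); split => // [m n mn|x Ix].
  by rewrite lerN2 hmono.
by have [|n hn] := hcof (- x); [rewrite /= opprK | exists n; rewrite lerNl].
Qed.

(** Continuity from below along closed intervals with end points in [I] that exhaust it. *)
Lemma le_measure_interval (nu : probability R R) (I : set R) (c : \bar R) :
  is_interval I -> (0 <= c)%E ->
  (forall x y, I x -> I y -> (nu [set z | (x <= z <= y)%R] <= c)%E) -> (nu I <= c)%E.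
Proof.
move=> itvI c0 Ic.
have [->|/set0P I0] := eqVneq I set0; first by rewrite measure0.
have [h [Ih hmono hcof]] := cofinal_sequence I0.
have [g [Ig gmono gcof]] := coinitial_sequence I0.
pose A n := [set z | g n <= z <= h n].
have mA n : measurable (A n).
  apply: is_interval_measurable => x y /andP[x1 x2] /andP[y1 y2] z /andP[xz zy].
  by apply/andP; split; [exact: le_trans xz | exact: le_trans y2].
have UA : \bigcup_n A n = I.
  apply/seteqP; split => [x [n _ /andP[gx xh]]|x Ix].
    by apply: (itvI (g n) (h n)); rewrite ?gx.
  have [n xn] := hcof _ Ix; have [m mx] := gcof _ Ix.
  exists (maxn m n) => //; apply/andP; split.
    by apply: le_trans mx; rewrite gmono // leq_maxl.
  by apply: le_trans xn _; rewrite hmono // leq_maxr.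
have : nu \o A @ \oo --> nu (\bigcup_n A n).
  apply: nondecreasing_cvg_mu => //; first exact: bigcup_measurable.
  move=> m n mn; apply/subsetPset => x /andP[gx xh]; apply/andP; split.
    by apply: le_trans gx; exact: gmono.
  by apply: le_trans xh _; exact: hmono.
rewrite UA => h_cvg; apply: (cvge_le _ h_cvg).
by apply: nearW => n /=; apply: Ic.
Qed.

(** In the first alternative [t] is the last point of its cell, so the half-line up to [t] is
    exactly a union of cells; otherwise its cell is light. *)
Lemma quantile_cells (nu : probability R R) n : (0 < n)%N ->
  exists kappa : R -> nat,
  [/\ {homo kappa : x y / x <= y >-> (x <= y)%N}, forall x, (kappa x <= n.*2)%N &
      forall t, (forall x, (kappa x <= kappa t)%N -> x <= t) \/
        (nu [set x | kappa x = kappa t] <= (n%:R^-1)%:E)%E].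
Proof.
move=> n0.
pose F x := fine (nu [set y | y <= x]).
pose G x := fine (nu [set y | y < x]).
have mle x : measurable [set y : R | y <= x].
  by apply: is_interval_measurable => a b /= _ bx y /andP[_ /le_trans]; apply.
have mlt x : measurable [set y : R | y < x].
  by apply: is_interval_measurable => a b /= _ bx y /andP[_ /le_lt_trans]; apply.
have fin A : measurable A -> nu A \is a fin_num by move=> mA; exact: fin_num_measure.
have le1 A : measurable A -> 0 <= fine (nu A) <= 1.
  move=> mA; rewrite fine_ge0 //= -lee_fin fineK ?fin //; exact: probability_le1.
have mono A B : measurable A -> measurable B -> A `<=` B -> fine (nu A) <= fine (nu B).
  by move=> mA mB AB; rewrite fine_le ?fin // le_measure ?inE.
have FG x y : x < y -> F x <= G y.
  by move=> xy; apply: mono => // z /= zx; exact: le_lt_trans xy.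
have GF x : G x <= F x by apply: mono => // z /= /ltW.
have Fmono x y : x <= y -> F x <= F y.
  by move=> xy; apply: mono => // z /= zx; exact: le_trans xy.
have Gmono x y : x <= y -> G x <= G y.
  by move=> xy; apply: mono => // z /= zx; exact: lt_le_trans xy.
pose tr r := Num.truncn (n%:R * r : R).
have tr_mono r s : r <= s -> (tr r <= tr s)%N.
  by move=> rs; apply: le_truncn; rewrite ler_wpM2l.
have tr_le r : r <= 1 -> (tr r <= n)%N.
  move=> r1; rewrite truncn_le_nat; apply: (@le_lt_trans _ _ n%:R).
    by rewrite ler_piMr.
  by rewrite ltr_nat.
(* Using both [F] and its left limit [G] isolates large atoms in their own cells. *)
pose kappa x := (tr (F x) + tr (G x))%N.
have kmono x y : x <= y -> (kappa x <= kappa y)%N.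
  by move=> xy; rewrite leq_add // tr_mono ?Fmono ?Gmono.
exists kappa; split=> // [x|t].
  rewrite -addnn leq_add // tr_le //.
    by case/andP: (le1 _ (mle x)).
  by case/andP: (le1 _ (mlt x)).
have [atom|] := pselect (forall x, (kappa x <= kappa t)%N -> x <= t); first by left.
move=> /existsNP[t' /not_implyP[kt' /negP]]; rewrite -ltNge => tt'; right.
have {}kt' : kappa t' = kappa t by apply/eqP; rewrite eqn_leq kt' kmono // ltW.
(* Within a cell having two points, [F] and [G] have the same integer part [j]
   after scaling by [n]. *)
have same x : kappa x = kappa t -> tr (F x) = tr (F t) /\ tr (G x) = tr (F t).
  have FGt : (tr (F t) <= tr (G t'))%N by exact/tr_mono/FG.
  have FF : (tr (F t) <= tr (F t'))%N by exact/tr_mono/Fmono/ltW.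
  have GG : (tr (G t) <= tr (G t'))%N by exact/tr_mono/Gmono/ltW.
  have GFt : (tr (G t) <= tr (F t))%N by exact/tr_mono/GF.
  have GFt' : (tr (G t') <= tr (F t'))%N by exact/tr_mono/GF.
  move: kt'; rewrite /kappa => kt' kx.
  have [xt|xt] := leP x t.
    have := tr_mono _ _ (Fmono _ _ xt); have := tr_mono _ _ (Gmono _ _ xt); lia.
  have := tr_mono _ _ (Fmono _ _ (ltW xt)); have := tr_mono _ _ (Gmono _ _ (ltW xt)); lia.
apply: le_measure_interval.
- move=> x y /= kx ky z /andP[xz zy]; apply/eqP; rewrite eqn_leq.
  by apply/andP; split; [rewrite -ky | rewrite -kx]; exact: kmono.
- by rewrite lee_fin invr_ge0.
move=> x y /same[_ Gx] /same[Fy _].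
have [xy|yx] := leP x y; last first.
  rewrite (_ : [set _ | _] = set0) ?measure0 ?lee_fin ?invr_ge0 //.
  by apply/seteqP; split => // z /= /andP[xz /(le_trans xz)]; rewrite leNgt yx.
have E : [set y0 | y0 <= y] = [set y0 | y0 < x] `|` [set z | x <= z <= y].
  apply/seteqP; split => z /=.
    by move=> zy; have [|xz] := ltP z x; [left | right; rewrite zy].
  by case=> [zx|/andP[]//]; exact/ltW/(lt_le_trans zx).
have mI : measurable [set z | x <= z <= y].
  apply: is_interval_measurable => a b /andP[a1 a2] /andP[b1 b2] z /andP[az zb].
  by apply/andP; split; [exact: le_trans az | exact: le_trans b2].
have : F y = G x + fine (nu [set z | x <= z <= y]).
  rewrite /F E measureU //; last first.
    by apply/seteqP; split => // z /= [zx /andP[]]; rewrite leNgt zx.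
  by rewrite fineD ?fin.
rewrite -[nu _ in leLHS](fineK (fin _ mI)) lee_fin => FyE.
rewrite (_ : fine _ = F y - G x); last by rewrite FyE addrC addKr.
have n0' : 0 < n%:R :> R by rewrite ltr0n.
rewrite -(ler_pM2l n0') mulfV ?gt_eqF // mulrBr.
(* With j the common integer part, n F y < j + 1 and j <= n G x, so the mass F y - G x of [x, y] is
   below 1 / n. *)
have Fy1 : n%:R * F y < (tr (F t)).+1%:R by rewrite -Fy; exact: truncnS_gt.
have Gx1 : (tr (F t))%:R <= n%:R * G x.
  by rewrite -Gx truncn_le mulr_ge0 //; case/andP: (le1 _ (mlt x)).
move: Fy1; rewrite -natr1; lra.
Qed.

End quantile_cells.

(** * Simulating a finite kernel *)

(* [f] need not be measurable, which spares the measurability of the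
   discrepancy, a supremum over uncountably many orthants. *)
Lemma le_ge0_integral_dominated d (T : measurableType d) (R : realType)
    (mu : {measure set T -> \bar R}) (f g : T -> \bar R) :
  (forall x, 0 <= f x)%E -> (forall x, f x <= g x)%E ->
  (\int[mu]_x f x <= \int[mu]_x g x)%E.
Proof.
move=> f0 fg; have g0 x : (0 <= g x)%E by exact: le_trans (fg x).
rewrite !ge0_integralTE //; apply: ereal_sup_le => _ [h hf <-].
by exists h => // x; exact: le_trans (fg x).
Qed.

Section finite_law.
Context {R : realType} {S : finType} (s0 : S).

(** The seed lives in [nat], with its discrete sigma-algebra, through an enumeration of [S]; indices
    past the enumeration decode to [s0] and carry no mass. *)
Definition decode (i : nat) : S := nth s0 (enum S) i.

Lemma sum_decode (f : S -> R) : \sum_(i < #|S|) f (decode i) = \sum_s f s.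
Proof. by rewrite cardE -[RHS]big_enum [RHS](big_nth s0) big_mkord. Qed.

Variables (w : S -> R) (w_ge0 : forall s, 0 <= w s) (w_sum : \sum_s w s = 1).

Definition weight (i : nat) : {nonneg R} := NngNum (w_ge0 (decode i)).

Definition finite_law : set nat -> \bar R :=
  msum (fun i => mscale (weight i) (\d_ i)) #|S|.

HB.instance Definition _ := Measure.on finite_law.

Lemma finite_lawE A : finite_law A = (\sum_(i < #|S|) w (decode i) * \1_A (i : nat))%:E.
Proof. by rewrite /finite_law /msum sumEFin. Qed.

Lemma finite_law_setT : finite_law [set: nat] = 1%E.
Proof.
rewrite finite_lawE -w_sum -(sum_decode w); congr (_%:E).
by apply: eq_bigr => i _; rewrite indicT mulr1.
Qed.

HB.instance Definition _ :=
  Measure_isProbability.Build _ _ _ finite_law finite_law_setT.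

Definition finite_probability : probability nat R := finite_law.

Lemma finite_probability_decode s : finite_probability [set i | decode i = s] = (w s)%:E.
Proof.
rewrite [LHS]finite_lawE; congr (_%:E).
transitivity (\sum_(i < #|S|) (fun s' => w s' * (s' == s)%:R) (decode i)).
  apply: eq_bigr => i _; rewrite indicE /=; congr (_ * (nat_of_bool _)%:R).
  by apply/idP/eqP => [/set_mem|] //= ?; apply/mem_set.
rewrite (sum_decode (fun s' => w s' * (s' == s)%:R)) (bigD1 s) //= eqxx mulr1.
by rewrite big1 ?addr0 // => s' /negPf ->; rewrite mulr0.
Qed.

End finite_law.

Section simulation.
Context {R : realType} {d : measure_display} {T : measurableType d} {K : finType}.
Variables (n : nat) (cell : T -> K) (rep : K -> T).
Hypothesis measurable_cell : forall c, measurable (cell @^-1` [set c]).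

Definition cells (x : n.-tuple T) : n.-tuple K := map_tuple cell x.

(** A point already in its prescribed cell stays in place, so a point changes only if its cell
    does. *)
Definition realize (x : n.-tuple T) (ys : n.-tuple K) : n.-tuple T :=
  [tuple if cell (tnth x i) == tnth ys i then tnth x i else rep (tnth ys i) | i < n].

(* As in Kuhn's theorem, a Markov kernel on a finite space is the law of a random
   map; drawing the values of this map independently makes the random map the
   seed of the algorithm. *)
Definition strategy := {ffun n.-tuple K -> n.-tuple K}.

Let s0 : strategy := [ffun xs => xs].

Definition play (z : n.-tuple T * nat) : n.-tuple T :=
  realize z.1 (decode s0 z.2 (cells z.1)).

Lemma measurable_cells (c : n.-tuple K) : measurable [set x | cells x = c].
Proof.
have -> : [set x | cells x = c] =
    \bigcap_(i in [set: 'I_n]) ((fun x => tnth x i) @^-1` (cell @^-1` [set tnth c i])).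
  apply/seteqP; split => x /= h; last first.
    by apply/eq_from_tnth => i; rewrite tnth_map; exact: h.
  by move=> i _ /=; rewrite -h tnth_map.
apply: fin_bigcap_measurable => [|i _]; first exact: finite_finset.
by rewrite -[X in measurable X]setTI; exact: measurable_tnth.
Qed.

(** For each of the countably many pairs of a cell tuple and a seed, an output coordinate is an
    input coordinate or a constant, on a measurable set. *)
Lemma measurable_play : measurable_fun setT play.
Proof.
apply/measurable_fun_tnthP => i _ B mB; rewrite setTI.
pose val (c : n.-tuple K * nat) (x : n.-tuple T) :=
  let y := tnth (decode s0 c.2 c.1) i in if tnth c.1 i == y then tnth x i else rep y.
have playE x j : tnth (play (x, j)) i = val (cells x, j) x.
  by rewrite /play tnth_mktuple /val /= tnth_map.
have -> : ((fun x => tnth x i) \o play) @^-1` B =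
    \bigcup_c (([set x | cells x = c.1] `&` (val c @^-1` B)) `*` [set c.2]).
  apply/seteqP; split => [[x j] xB|[x j] [[c j'] _ [[/= xc xB] /= jj]]].
    by exists (cells x, j) => //=; split=> //; split=> //=; rewrite -playE.
  by rewrite /preimage /= playE xc jj.
apply: countable_bigcupT_measurable => // c; apply: measurableX => //.
apply: measurableI; first exact: measurable_cells.
have mval : measurable_fun setT (val c).
  by rewrite /val; case: eqP => _; [exact: measurable_tnth | exact: measurable_cst].
by rewrite -[X in measurable X]setTI; exact: mval.
Qed.

HB.instance Definition _ := isMeasurableFun.Build _ _ _ _ play measurable_play.

Variable k : n.-tuple K -> n.-tuple K -> R.
Hypotheses (k_ge0 : forall xs ys, 0 <= k xs ys)
  (k_sum : forall xs, \sum_ys k xs ys = 1).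

Definition strategy_weight (s : strategy) : R := \prod_xs k xs (s xs).

Lemma strategy_weight_ge0 s : 0 <= strategy_weight s.
Proof. by rewrite /strategy_weight prodr_ge0. Qed.

(** The value of the random map at [xs] has law [k xs]: once the product is distributed, the factors
    at the other tuples sum to 1. *)
Lemma sum_strategy_weight_at (xs : n.-tuple K) (f : n.-tuple K -> R) :
  \sum_s strategy_weight s * f (s xs) = \sum_ys k xs ys * f ys.
Proof.
pose g xs' ys := k xs' ys * (if xs' == xs then f ys else 1).
transitivity (\prod_xs' \sum_ys g xs' ys).
  rewrite bigA_distr_bigA /=; apply: eq_bigr => s _.
  rewrite /g big_split /=; congr (_ * _).
  rewrite (bigD1 xs) //= eqxx big1 ?mulr1 // => xs' /negPf -> //.
rewrite (bigD1 xs) //= [X in _ * X]big1 ?mulr1 => [|xs' /negPf ne].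
  by apply: eq_bigr => ys _; rewrite /g eqxx.
rewrite -[RHS](k_sum xs'); apply: eq_bigr => ys _.
by rewrite /g ne mulr1.
Qed.

Lemma sum_strategy_weight : \sum_s strategy_weight s = 1.
Proof.
rewrite /strategy_weight -(bigA_distr_bigA (fun xs ys => k xs ys)).
by rewrite big1.
Qed.

Definition played_algorithm : randomized_algorithm R (n.-tuple T) (n.-tuple T) :=
  @RandomizedAlgorithm R _ _ (n.-tuple T) (n.-tuple T) _ nat
    (finite_probability s0 strategy_weight_ge0 sum_strategy_weight) play.

Variable mu : probability T R.

(** The cell tuple and the strategy cut the product space into finitely many rectangles, on each of
    which the integrand is bounded by a value of [F]; independence gives their masses. *)
Lemma expectation_played_le (disp : measure_display) (Omega : measurableType disp)
    (P : probability Omega R) (X : 'I_n -> {RV P >-> T})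
    (Phi : n.-tuple T -> n.-tuple T -> R) (F : n.-tuple K -> n.-tuple K -> R) :
  iid_with_law X mu -> (forall xs ys, 0 <= F xs ys) ->
  (forall x y, 0 <= Phi x y) -> (forall x ys, Phi x (realize x ys) <= F (cells x) ys) ->
  ('E_(P \x seed_law played_algorithm)[fun z =>
      Phi (sample_of X z.1) (played_algorithm (sample_of X z.1, z.2))] <=
    (coupling_mean (fun c => fine (mu (cell @^-1` [set c]))) k F)%:E)%E.
Proof.
move=> [indepX lawX] F0 Phi0 PhiF.
rewrite unlock.
pose A (c : n.-tuple K) := [set w | cells (sample_of X w) = c].
pose B (s : strategy) := [set i | decode s0 i = s].
pose J : {set 'I_n} := [set: 'I_n]%SET.
have AE c : A c = [set w | forall i, i \in J -> (cell @^-1` [set tnth c i]) (X i w)].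
  apply/seteqP; split => w /=.
    by move=> <- i _; rewrite /preimage /cells /sample_of /= tnth_map tnth_mktuple.
  move=> h; apply/eq_from_tnth => i.
  by rewrite /cells /sample_of tnth_map tnth_mktuple; apply: h; rewrite inE.
have mA c : measurable (A c).
  have -> : A c = \bigcap_(i in [set: 'I_n]) (X i @^-1` (cell @^-1` [set tnth c i])).
    by rewrite AE; apply/seteqP; split => w h i _; apply: h; rewrite ?inE.
  apply: fin_bigcap_measurable => [|i _]; first exact: finite_finset.
  exact: measurable_funPTI.
have PA c : P (A c) = (\prod_(x <- c) fine (mu (cell @^-1` [set x])))%:E.
  rewrite AE (indepX J (fun i => cell @^-1` [set tnth c i])) // big_tuple -prodEFin.
  apply: eq_big => [i|i _]; rewrite ?inE //.
  by rewrite -(lawX i) // fineK // fin_num_measure.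
apply: (@le_trans _ _ (\int[P \x seed_law played_algorithm]_z
    \sum_(cs : n.-tuple K * strategy)
      ((F cs.1 (cs.2 cs.1))%:E * (\1_(A cs.1 `*` B cs.2) z)%:E))%E).
  apply: le_ge0_integral_dominated => [z|[w i]]; first by rewrite lee_fin.
  under eq_bigr do rewrite -EFinM.
  rewrite sumEFin lee_fin.
  rewrite (bigD1 (cells (sample_of X w), decode s0 i)) //=.
  apply: ler_wpDr; first by rewrite sumr_ge0 // => cs _; rewrite mulr_ge0.
  by rewrite indicE mem_set // mulr1; exact: PhiF.
have lawAB cs : (P \x seed_law played_algorithm)%E (A cs.1 `*` B cs.2) =
    ((\prod_(x <- cs.1) fine (mu (cell @^-1` [set x]))) * strategy_weight cs.2)%:E.
  rewrite EFinM -PA -(finite_probability_decode s0 strategy_weight_ge0 sum_strategy_weight).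
  exact: product_measure1E.
have mAB cs : measurable (A cs.1 `*` B cs.2) by exact: measurableX.
rewrite ge0_integral_sum //; last 2 first.
- by move=> cs; apply: emeasurable_funM => //; exact/measurable_EFinP/measurable_indic.
- by move=> cs z _; rewrite mule_ge0 // lee_fin.
rewrite (eq_bigr (fun cs : n.-tuple K * strategy => (F cs.1 (cs.2 cs.1) * ((\prod_(x <- cs.1)
    fine (mu (cell @^-1` [set x]))) * strategy_weight cs.2))%:E)); last first.
  move=> cs _; rewrite ge0_integralZl_EFin //; last first.
    exact/measurable_EFinP/measurable_indic.
  rewrite integral_indic // setIT EFinM; congr (_ * _)%E; exact: lawAB.
rewrite sumEFin lee_fin.
rewrite -(pair_bigA _ (fun c (s : strategy) => F c (s c) *
  (\prod_(x <- c) fine (mu (cell @^-1` [set x])) * strategy_weight s))) /=.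
apply: ler_sum => c _.
have := sum_strategy_weight_at c (fun ys => F c ys).
under [X in _ <= X]eq_bigr do rewrite -mulrA.
rewrite -mulr_sumr => <-; rewrite mulr_sumr; apply: ler_sum => s _.
by rewrite le_eqVlt; apply/orP; left; apply/eqP; ring.
Qed.

End simulation.

(** * Orthants and grids *)

(** Finite additivity, by induction on a duplicate-free list of cells to which the event is
    restricted. *)
Lemma measure_cells d (T : measurableType d) (R : realType) (K : finType)
    (mu : probability T R) (cell : T -> K) (Q : pred K) :
  (forall c, measurable (cell @^-1` [set c])) ->
  measurable [set x | Q (cell x)] /\
  fine (mu [set x | Q (cell x)]) = \sum_c fine (mu (cell @^-1` [set c])) * (Q c)%:R.
Proof.
move=> mcell.
suff H r : uniq r -> measurable [set x | Q (cell x) && (cell x \in r)] /\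
    fine (mu [set x | Q (cell x) && (cell x \in r)]) =
    \sum_(c <- r) fine (mu (cell @^-1` [set c])) * (Q c)%:R.
  have := H _ (index_enum_uniq K).
  rewrite (_ : [set x | _ && _] = [set x | Q (cell x)]) //.
  by apply/seteqP; split => x /=; rewrite mem_index_enum andbT.
elim: r => [_|c r IH /= /andP[cr /IH[mr Er]]].
  rewrite big_nil (_ : [set x | _] = set0) ?measure0 //.
  by apply/seteqP; split => x //=; rewrite andbF.
have mc : measurable [set x | Q c && (cell x == c)].
  case: (Q c) => /=; last by rewrite (_ : [set x | false] = set0) // -subset0.
  rewrite (_ : [set x | _] = cell @^-1` [set c]) //.
  by apply/seteqP; split => x /= /eqP.
have E : [set x | Q (cell x) && (cell x \in c :: r)] =
    [set x | Q c && (cell x == c)] `|` [set x | Q (cell x) && (cell x \in r)].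
  apply/seteqP; split => x /=; rewrite inE.
    by case/andP => Qx /orP[/eqP <-|xr]; [left; rewrite Qx eqxx | right; rewrite Qx].
  by case=> /andP[Qx]; [move/eqP=> -> | move=> ->]; rewrite Qx ?eqxx ?orbT.
rewrite E; split; first exact: measurableU.
rewrite measureU //; last first.
  apply/seteqP; split => x //= [/andP[_ /eqP ->] /andP[_]].
  by rewrite (negPf cr).
rewrite fineD ?fin_num_measure // big_cons Er; congr (_ + _).
case: (Q c) => /=.
  rewrite mulr1 (_ : [set x | _] = cell @^-1` [set c]) //.
  by apply/seteqP; split => x /= /eqP.
by rewrite mulr0 (_ : [set x | false] = set0) ?measure0 // -subset0.
Qed.

Section grid.
Context {R : realType}.
Variables (d n : nat) (mu : probability (d.-tuple R) R).
Hypothesis n_gt0 : (0 < n)%N.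
Variable kappa : 'I_d -> R -> nat.
Hypotheses (kappa_mono : forall i, {homo kappa i : x y / x <= y >-> (x <= y)%N})
  (kappa_le : forall i x, (kappa i x <= n.*2)%N).
Hypothesis kappa_small : forall i t, (forall x, (kappa i x <= kappa i t)%N -> x <= t) \/
  (mu [set x | kappa i (tnth x i) = kappa i t] <= (n%:R^-1)%:E)%E.

Definition grid_index (x : d.-tuple R) : {ffun 'I_d -> 'I_n.*2.+1} :=
  [ffun i => inord (kappa i (tnth x i))].

Lemma grid_indexE x i : grid_index x i = kappa i (tnth x i) :> nat.
Proof. by rewrite ffunE inordK // ltnS. Qed.

(* Only nonempty cells are kept, so that every cell has a representative. *)
Definition grid : finType :=
  {c : {ffun 'I_d -> 'I_n.*2.+1} | `[< exists x, grid_index x = c >]}.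

Definition grid_cell (x : d.-tuple R) : grid :=
  exist _ (grid_index x) (asboolT (ex_intro _ x erefl)).

Definition grid_rep (c : grid) : d.-tuple R := projT1 (cid (asboolW (svalP c))).

Lemma grid_repK : cancel grid_rep grid_cell.
Proof. by move=> c; apply/val_inj; rewrite /= /grid_rep; case: cid. Qed.

Lemma measurable_coord i A : measurable A ->
  measurable [set x : d.-tuple R | A (tnth x i)].
Proof.
move=> mA; rewrite -[X in measurable X]setTI.
exact: (measurable_tnth (n := d) i measurableT mA).
Qed.

Lemma measurable_grid_cell c : measurable (grid_cell @^-1` [set c]).
Proof.
rewrite (_ : _ @^-1` _ = \bigcap_(i in [set: 'I_d])
    [set x | [set y | kappa i y = sval c i :> nat] (tnth x i)]).
  apply: fin_bigcap_measurable => [|i _]; first exact: finite_finset.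
  apply: measurable_coord; apply: is_interval_measurable => x y /= kx ky z /andP[xz zy].
  by apply/eqP; rewrite eqn_leq; apply/andP; split; [rewrite -ky | rewrite -kx];
    exact: kappa_mono.
apply/seteqP; split => x /=; first by move=> <- i _ /=; rewrite grid_indexE.
move=> h; apply/val_inj/ffunP => i; apply/val_inj.
by rewrite /= grid_indexE h.
Qed.

Lemma card_grid : (#|grid| <= n.*2.+1 ^ d)%N.
Proof.
by rewrite card_sig; apply: leq_trans (max_card _) _; rewrite card_ffun !card_ord.
Qed.

(** [a i] counts the slices kept along axis [i], from 0 to 2 n + 1 of them; hence 2 n + 2 choices of
    cut per axis. *)
Definition below (a : 'I_d -> nat) (c : grid) : bool := [forall i, (sval c i < a i)%N].

Let p (c : grid) : R := fine (mu (grid_cell @^-1` [set c])).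

Let law (Q : pred grid) := measure_cells mu Q measurable_grid_cell.

Lemma measurable_lower_orthant (t : d.-tuple R) : measurable (lower_orthant t).
Proof.
rewrite (_ : lower_orthant t = \bigcap_(i in [set: 'I_d])
    [set x | [set y | y <= tnth t i] (tnth x i)]).
  apply: fin_bigcap_measurable => [|i _]; first exact: finite_finset.
  apply: measurable_coord; apply: is_interval_measurable => x y /= _ yt z /andP[_ zy].
  exact: le_trans yt.
by apply/seteqP; split => x /= h i => [_|]; exact: h.
Qed.

(* In each coordinate where the cell of [t i] is not cut exactly, the cell has
   mass at most [1 / n]; summing over the coordinates gives [d / n]. *)
Lemma orthant_sandwich (t : d.-tuple R) : exists lo hi : {ffun 'I_d -> 'I_n.*2.+2},
  [/\ forall x, below (fun i => lo i) (grid_cell x) -> lower_orthant t x,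
      forall x, lower_orthant t x -> below (fun i => hi i) (grid_cell x) &
      \sum_c p c * (below (fun i => hi i) c)%:R <=
      \sum_c p c * (below (fun i => lo i) c)%:R + d%:R / n%:R].
Proof.
pose k i := kappa i (tnth t i).
pose exact_at i := `[< forall x, (kappa i x <= k i)%N -> x <= tnth t i >].
have kn i : (k i <= n.*2)%N by exact: kappa_le.
(* The slice of [t] is included in [lo] only where the cut is exact; [hi] always includes it. *)
pose lo : {ffun 'I_d -> 'I_n.*2.+2} := [ffun i => inord (k i + exact_at i)].
pose hi : {ffun 'I_d -> 'I_n.*2.+2} := [ffun i => inord (k i).+1].
have loE i : lo i = (k i + exact_at i)%N :> nat.
  by rewrite ffunE inordK //; have := kn i; case: (exact_at i); lia.
have hiE i : hi i = (k i).+1 :> nat by rewrite ffunE inordK // !ltnS.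
exists lo, hi; split.
- move=> x /forallP xlo i; have := xlo i; rewrite loE /= grid_indexE.
  have [/asboolP ex|_] := boolP (exact_at i).
    by rewrite addn1 ltnS => /ex.
  rewrite addn0 ltnNge => /negP xk; rewrite leNgt; apply/negP => tx; apply: xk.
  exact/kappa_mono/ltW.
- move=> x tx; apply/forallP => i; rewrite hiE /= grid_indexE ltnS.
  exact/kappa_mono/tx.
(* A cell below [hi] but not below [lo] has index [k i] on some axis where the cut is not exact;
   union bound over these axes. *)
- apply: (@le_trans _ _ (\sum_c p c * (below (fun i => lo i) c)%:R +
     \sum_(i | ~~ exact_at i) \sum_c p c * (sval c i == k i :> nat)%:R)).
    rewrite exchange_big -big_split /=; apply: ler_sum => c _.
    rewrite -mulr_sumr -mulrDr ler_wpM2l ?fine_ge0 //.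
    have [hic|_] := boolP (below _ c); last by rewrite addr_ge0 ?sumr_ge0.
    have [_|] := boolP (below (fun i => lo i) c); first by rewrite lerDl sumr_ge0.
    case/forallPn => i; rewrite -leqNgt loE add0r => ki.
    have := forallP hic i; rewrite hiE ltnS => ci.
    have nex : ~~ exact_at i by apply: contraL ki => ->; rewrite addn1 -ltnNge ltnS.
    rewrite (bigD1 i) //= (_ : _ == _) ?lerDl ?sumr_ge0 //.
    by rewrite eqn_leq ci; move: ki; rewrite (negPf nex) addn0.
  rewrite lerD2l.
  apply: (@le_trans _ _ (\sum_(i < d) n%:R^-1)); last first.
    by rewrite sumr_const card_ord mulr_natl.
  rewrite big_mkcond /=; apply: ler_sum => i _.
  case: ifPn => [/asboolPn nex|_]; last by rewrite invr_ge0.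
  have [|small] := kappa_small i (tnth t i); first by move/nex.
  rewrite -(law (fun c => sval c i == k i :> nat)).2 -lee_fin fineK ?fin_num_measure //.
    rewrite (_ : [set x | _] = [set x | kappa i (tnth x i) = kappa i (tnth t i)]) //.
    by apply/seteqP; split => x /=; rewrite grid_indexE => /eqP.
  exact: (law (fun c => sval c i == k i :> nat)).1.
Qed.

Definition cell_deviation (ys : seq grid) (a : 'I_d -> nat) : R :=
  \sum_(y <- ys) ((below a y)%:R - \sum_c p c * (below a c)%:R).

(** Both measures are monotone, so an orthant inherits the error of the two grid orthants around it,
    up to their difference of mass d / n. *)
Lemma orthant_discrepancy_le (y : n.-tuple (d.-tuple R)) (eps : R) :
  (forall a : {ffun 'I_d -> 'I_n.*2.+2},
    `|cell_deviation (cells grid_cell y) (fun i => a i)| <= eps) ->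
  orthant_discrepancy mu y <= eps / n%:R + d%:R / n%:R.
Proof.
move=> dev; apply: ge_sup.
  by eexists; exists (lower_orthant [tuple 0 | i < d]) => //; exists [tuple 0 | i < d].
move=> _ [_ [t _ <-] <-].
have n0 : 0 < n%:R :> R by rewrite ltr0n.
have [lo [hi [loB Bhi hilo]]] := orthant_sandwich t.
pose L a := [set x | below a (grid_cell x)].
have emp (a : {ffun 'I_d -> 'I_n.*2.+2}) :
    `|empirical_measure y (L (fun i => a i)) - \sum_c p c * (below (fun i => a i) c)%:R|
    <= eps / n%:R.
  rewrite ler_pdivlMr // -[X in _ * X](gtr0_norm n0) -normrM.
  rewrite (_ : _ * _ = cell_deviation (cells grid_cell y) (fun i => a i)) //.
  rewrite /cell_deviation sumrB big_const_seq count_predT size_tuple iter_addr_0.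
  rewrite mulrBl /empirical_measure mulrC mulrA mulfV ?gt_eqF // mul1r mulr_natr.
  congr (_ - _); rewrite big_tuple; apply: eq_bigr => i _.
  rewrite indicE tnth_map; congr (nat_of_bool _)%:R.
  by apply/idP/idP => [/set_mem|/mem_set].
have emp_mono (A B : set (d.-tuple R)) : A `<=` B ->
    empirical_measure y A <= empirical_measure y B :> R.
  move=> AB; rewrite /empirical_measure ler_wpM2l ?invr_ge0 //.
  apply: ler_sum => i _; rewrite !indicE ler_nat.
  by case: (boolP (_ \in A)) => // /set_mem /AB /mem_set ->.
have mL (a : {ffun 'I_d -> 'I_n.*2.+2}) : measurable (L (fun i => a i)).
  exact: (law (below (fun i => a i))).1.
have muL (a : {ffun 'I_d -> 'I_n.*2.+2}) :
    fine (mu (L (fun i => a i))) = \sum_c p c * (below (fun i => a i) c)%:R.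
  exact: (law (below (fun i => a i))).2.
have mu_mono (A B : set (d.-tuple R)) : measurable A -> measurable B -> A `<=` B ->
    fine (mu A) <= fine (mu B).
  by move=> mA mB AB; rewrite fine_le ?fin_num_measure // le_measure ?inE.
have mB := measurable_lower_orthant t.
have e1 := emp_mono _ _ (loB : L (fun i => lo i) `<=` _).
have e2 := emp_mono _ _ (Bhi : _ `<=` L (fun i => hi i)).
have m1 := mu_mono _ _ (mL lo) mB loB.
have m2 := mu_mono _ _ mB (mL hi) Bhi.
rewrite !muL in m1 m2.
move: (emp lo) (emp hi); rewrite !ler_norml => /andP[? ?] /andP[? ?].
by apply/andP; split; lra.
Qed.

(** The bound 1 is what serves on the failure event. *)
Lemma orthant_discrepancy_itv (y : n.-tuple (d.-tuple R)) :
  0 <= orthant_discrepancy mu y <= 1.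
Proof.
have n0 : 0 < n%:R :> R by rewrite ltr0n.
pose B0 : set (d.-tuple R) := lower_orthant [tuple 0 | i < d].
have ub1 : ubound [set `|empirical_measure y B - fine (mu B)|
    | B in range (@lower_orthant _ d)] 1.
  move=> _ [_ [t _ <-] <-]; have mB := measurable_lower_orthant t.
  have : 0 <= fine (mu (lower_orthant t)) <= 1.
    rewrite fine_ge0 //= -lee_fin fineK ?fin_num_measure //; exact: probability_le1.
  have : 0 <= (empirical_measure y (lower_orthant t) : R) <= 1.
    rewrite /empirical_measure mulr_ge0 ?invr_ge0 ?sumr_ge0 //=.
    rewrite mulrC ler_pdivrMr // mul1r -[leRHS]mulr1 -[n in leRHS]card_ord mulr_natl -sumr_const.
    by apply: ler_sum => i _; rewrite indicE lern1 leq_b1.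
  by move=> /andP[? ?] /andP[? ?]; rewrite ler_norml; apply/andP; split; lra.
apply/andP; split; last first.
  by apply: ge_sup => //; eexists; exists B0 => //; exists [tuple 0 | i < d].
apply: (@le_trans _ _ `|empirical_measure y B0 - fine (mu B0)|) => //.
apply: ub_le_sup; first by exists 1.
by exists B0 => //; exists [tuple 0 | i < d].
Qed.

End grid.

(** * Marginal laws and the passage from cells to points *)

Definition coordinate (R : realType) d (i : 'I_d) (x : d.-tuple R) : R := tnth x i.

Lemma measurable_coordinate (R : realType) d (i : 'I_d) :
  measurable_fun setT (@coordinate R d i).
Proof. exact: measurable_tnth. Qed.

HB.instance Definition _ (R : realType) d (i : 'I_d) :=
  isMeasurableFun.Build _ _ _ _ (@coordinate R d i) (@measurable_coordinate R d i).

Lemma coordinate_quantile_cells (R : realType) d n (mu : probability (d.-tuple R) R) :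
  (0 < n)%N -> exists kappa : 'I_d -> R -> nat,
  [/\ forall i, {homo kappa i : x y / x <= y >-> (x <= y)%N},
      forall i x, (kappa i x <= n.*2)%N &
      forall i t, (forall x, (kappa i x <= kappa i t)%N -> x <= t) \/
        (mu [set x | kappa i (tnth x i) = kappa i t] <= (n%:R^-1)%:E)%E].
Proof.
move=> n0.
have [kappa H] := choice (fun i : 'I_d =>
  quantile_cells (distribution mu (@coordinate R d i)) n0).
by exists kappa; split=> i; case: (H i).
Qed.

Lemma coupling_mean_cstD (R : realType) (K : finType) n (p : K -> R)
    (k : n.-tuple K -> n.-tuple K -> R) (e : R) F :
  \sum_x p x = 1 -> (forall xs, \sum_ys k xs ys = 1) ->
  coupling_mean p k (fun xs ys => e + F xs ys) = e + coupling_mean p k F.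
Proof.
move=> p1 k1; rewrite /coupling_mean.
pose w (xs : n.-tuple K) := \prod_(x <- xs) p x.
rewrite (eq_bigr (fun xs => w xs * e + \sum_ys w xs * k xs ys * F xs ys)); last first.
  move=> xs _; rewrite (_ : w xs * e = \sum_ys w xs * e * k xs ys); last first.
    by rewrite -mulr_sumr k1 mulr1.
  rewrite -big_split /=.
  by apply: eq_bigr => ys _; rewrite /w; ring.
rewrite big_split /= /w -mulr_suml; congr (_ + _); rewrite -[RHS]mul1r; congr (_ * _).
elim: n {w k F k1} => [|n IH]; first by rewrite sum_tuple0 big_nil.
rewrite sum_tuple_cons -[RHS]IH; apply: eq_bigr => xs _.
transitivity (\sum_x p x * \prod_(y <- xs) p y).
  by apply: eq_bigr => x _; rewrite /= big_cons.
by rewrite -mulr_suml p1 mul1r.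
Qed.

Lemma num_changed_realize d (T : measurableType d) (K : finType) n (cell : T -> K)
    (rep : K -> T) (x : n.-tuple T) (ys : n.-tuple K) :
  (num_changed x (realize cell rep x ys) <= num_changed (cells cell x) ys)%N.
Proof.
apply: subset_leq_card; apply/fintype.subsetP => i; rewrite !inE tnth_mktuple tnth_map eq_sym.
by apply: contraNneq => ->; rewrite eqxx.
Qed.

Lemma cells_realize d (T : measurableType d) (K : finType) n (cell : T -> K)
    (rep : K -> T) (x : n.-tuple T) (ys : n.-tuple K) :
  cancel rep cell -> cells cell (realize cell rep x ys) = ys.
Proof.
move=> repK; apply/eq_from_tnth => i; rewrite tnth_map tnth_mktuple.
by case: eqP => // _; rewrite repK.
Qed.

(** * Numerical bounds *)

(** From exp (- 1/2) >= 1 - 1/2 by inversion. *)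
Lemma ln2_ge_half (R : realType) : 2^-1 <= ln (2 : R).
Proof.
rewrite -[leLHS]expRK ler_ln ?posrE ?expR_gt0 //.
rewrite -[leLHS]invrK -expRN -[leRHS]invrK lef_pV2 ?posrE ?invr_gt0 ?expR_gt0 //.
by apply: le_trans (expR_ge1Dx _); lra.
Qed.

(** By minimality of J, 2^J < 2 (2 n + 2) <= 8 n <= (2 n)^3; then ln 2 >= 1/2 is used. *)
Lemma up_log_le_ln (R : realType) n : (0 < n)%N ->
  (up_log 2 n.*2.+2)%:R <= 6 * ln (2 * n%:R : R).
Proof.
move=> n0; set J := up_log _ _.
have J0 : (0 < J)%N by rewrite up_log_gt0.
have J8 : (2 ^ J <= (2 * n) ^ 3)%N.
  have := @up_log_gtn 2 n.*2.+2 isT isT; rewrite -/J -(prednK J0) /= expnS => h.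
  apply: (@leq_trans (8 * n)); last first.
    by rewrite expnMn leq_pmul2l // !expnS expn0 muln1 leq_pmulr // muln_gt0 n0.
  lia.
have n0' : 0 < 2 * n%:R :> R by rewrite mulr_gt0 ?ltr0n.
have : ln ((2 : R) ^+ J) <= ln ((2 * n%:R) ^+ 3).
  by rewrite ler_ln ?posrE ?exprn_gt0 // -natrM -!natrX ler_nat.
rewrite !lnXn // -[ln 2 *+ J]mulr_natl -[_ *+ 3]mulr_natl.
have := mulr_ge0 (ler0n R J) (_ : 0 <= ln 2 - 2^-1); rewrite subr_ge0.
move=> /(_ (ln2_ge_half R)); lra.
Qed.

(** Multiplied by the tail (2 n)^(-6 d), the count n K^2 + 2 I becomes at most 1 / n. The proof uses
    2 n + 2 <= (2 n)^2, n (n + 2) <= (2 n)^2 and 2 + 4 d <= 6 d. *)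
Lemma failure_count_le d n K I : (0 < d)%N -> (0 < n)%N ->
  (K <= n.*2.+1 ^ d)%N -> (I <= n.*2.+2 ^ d)%N ->
  (n * (n * K ^ 2 + 2 * I) <= (2 * n) ^ (6 * d))%N.
Proof.
move=> d0 n0 KN IN; set N := n.*2.+2.
have NN : (N ^ d <= N ^ (2 * d))%N by rewrite leq_pexp2l // leq_pmull.
have K2 : (K ^ 2 <= N ^ (2 * d))%N.
  rewrite mulnC expnM leq_sqr (leq_trans KN) // leq_exp2r //.
have N4 : (N <= (2 * n) ^ 2)%N by rewrite /N -mul2n expnS expn1; nia.
apply: (@leq_trans ((2 * n) ^ 2 * N ^ (2 * d))); last first.
  apply: (@leq_trans ((2 * n) ^ 2 * ((2 * n) ^ 2) ^ (2 * d))).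
    by rewrite leq_pmul2l ?expn_gt0 ?muln_gt0 ?n0 // leq_exp2r // muln_gt0.
  by rewrite -expnM -expnD leq_pexp2l ?muln_gt0 ?n0 //; lia.
have I2 := leq_trans IN NN.
apply: (@leq_trans (n * (n * N ^ (2 * d) + 2 * N ^ (2 * d)))).
  by rewrite leq_mul2l leq_add ?orbT // leq_mul2l ?K2 ?I2 orbT.
rewrite -mulnDl mulnA leq_mul2r; apply/orP; right.
by rewrite expnMn; nia.
Qed.

(** The left side is of order l^(d + 1) / m up to C^d, with l = ln (2 n); as l may be below 1,
    passing to l^(3 d / 2 + 1) costs a factor 2^d. In the constant, 196 = 192 + 4, 12 = 2 * 6 comes
    from d <= 2^d and J <= 6 l, and 2 from sqrt l >= 1/2. *)
Lemma error_bound (R : realType) d n J (m : R) : (0 < d)%N -> (0 < n)%N ->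
  0 < m <= n%:R -> J%:R <= 6 * ln (2 * n%:R : R) ->
  32 * (J ^ d)%:R / (m / n%:R) * (6 * d%:R * ln (2 * n%:R)) / n%:R +
    d%:R / n%:R + n%:R^-1 <=
  (196 * 12 * 2) ^+ d * ln (2 * n%:R) `^ (3 * d%:R / 2 + 1) / m.
Proof.
move=> d0 n0 /andP[m0 mn]; set l := ln _ => Jl.
have n0' : 0 < n%:R :> R by rewrite ltr0n.
have l2 : 2^-1 <= l.
  apply: le_trans (ln2_ge_half R) _; rewrite ler_ln ?posrE ?mulr_gt0 //.
  by rewrite ler_pMr // ler1n.
have l0 : 0 < l by lra.
have -> : 32 * (J ^ d)%:R / (m / n%:R) * (6 * d%:R * l) / n%:R =
    192 * d%:R * (J ^ d)%:R * l / m by field; rewrite !gt_eqF.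
have nm : n%:R^-1 <= m^-1 by rewrite lef_pV2 ?posrE.
apply: (@le_trans _ _ ((192 * d%:R * (J ^ d)%:R * l + (d%:R + 1)) / m)).
  rewrite [leRHS]mulrDl -addrA lerD2l -[X in _ + X]mul1r -mulrDl.
  by rewrite ler_wpM2l.
rewrite ler_pM2r ?invr_gt0 //.
have d2 : d%:R <= 2 ^+ d :> R by rewrite -natrX ler_nat ltnW // ltn_expl.
have powE : l `^ (3 * d%:R / 2 + 1) = l ^+ d.+1 * Num.sqrt l ^+ d.
  rewrite (_ : 3 * d%:R / 2 + 1 = d.+1%:R + 2^-1 * d%:R); last by rewrite -natr1; field.
  rewrite powRD; last by rewrite (gt_eqF l0) implybT.
  rewrite powR_mulrn ?(ltW l0) // powRrM powR12_sqrt ?(ltW l0) //.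
  by rewrite powR_mulrn ?sqrtr_ge0.
have sq : 2^-1 <= Num.sqrt l.
  rewrite -[leLHS](@ger0_norm) // -sqrtr_sqr ler_sqrt ?sqr_ge0 ?(ltW l0) //.
  by lra.
have lower (B : R) : 0 <= B ->
    B ^+ d * l ^+ d.+1 <= (B * 2) ^+ d * l `^ (3 * d%:R / 2 + 1).
  move=> B0; rewrite powE mulrCA [leLHS]mulrC; apply: ler_wpM2l.
    by rewrite exprn_ge0 // ltW.
  rewrite -exprMn -mulrA; apply: lerXn2r; rewrite ?nnegrE //.
    by rewrite !mulr_ge0 ?sqrtr_ge0.
  by rewrite ler_peMr //; lra.
apply: le_trans (lower (196 * 12) _); last by rewrite mulr_ge0.
have W : (J ^ d)%:R <= (6 * l) ^+ d.
  by rewrite natrX lerXn2r ?nnegrE ?mulr_ge0 ?(ltW l0).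
have part1 : 192 * d%:R * (J ^ d)%:R * l <= 192 * 12 ^+ d * l ^+ d.+1.
  apply: (@le_trans _ _ (192 * 2 ^+ d * (6 * l) ^+ d * l)).
    rewrite ler_wpM2r ?(ltW l0) // ler_pM ?mulr_ge0 ?ler_wpM2l //.
  rewrite (_ : 12 = 2 * 6); last by lra.
  by rewrite !exprMn exprSr; lra.
have part2 : d%:R + 1 <= 4 * 12 ^+ d * l ^+ d.+1.
  have l1 : 1 <= (2 * l) ^+ d.+1 by rewrite exprn_ege1 //; lra.
  have one : 1 <= 2 ^+ d :> R by rewrite exprn_ege1 //; lra.
  apply: (@le_trans _ _ (2 * 2 ^+ d * (2 * l) ^+ d.+1)).
    apply: (@le_trans _ _ (2 * 2 ^+ d)); first by lra.
    by rewrite ler_peMr ?mulr_ge0 ?exprn_ge0.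
  rewrite exprMn mulrA ler_wpM2r ?exprn_ge0 ?(ltW l0) //.
  rewrite exprS (_ : _ * _ = 4 * (2 ^+ d * 2 ^+ d)); last by ring.
  rewrite ler_wpM2l // -exprMn lerXn2r ?nnegrE //; lra.
apply: le_trans (lerD part1 part2) _.
rewrite -mulrDl ler_wpM2r ?exprn_ge0 ?(ltW l0) // -mulrDl.
rewrite exprMn ler_wpM2r ?exprn_ge0 //.
rewrite -(prednK d0) exprS.
have : 1 <= 196 ^+ d.-1 :> R by rewrite exprn_ege1 //; lra.
lra.
Qed.

(** * Choice of the parameters and conclusion *)

Unset Implicit Arguments.

Theorem theorem1p1 (R : realType) :
  exists C : R, 0 < C /\
  forall (d n : nat), (1 <= d)%N -> (1 <= n)%N ->
  forall (mu : probability (d.-tuple R) R) (m : R), 0 < m -> m <= n%:R ->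
  exists A : randomized_algorithm R (n.-tuple (d.-tuple R))
                                    (n.-tuple (d.-tuple R)),
  forall (disp : measure_display) (Omega : measurableType disp)
    (P : probability Omega R) (X : 'I_n -> {RV P >-> d.-tuple R}),
  iid_with_law X mu ->
  let Y := fun z : Omega * seed A => A (sample_of X z.1, z.2) in
  ('E_(P \x seed_law A)[fun z => (num_changed (sample_of X z.1) (Y z))%:R]
     <= m%:E)%E /\
  ('E_(P \x seed_law A)[fun z => orthant_discrepancy mu (Y z)]
     <= (C ^+ d * ln (2 * n%:R) `^ (3 * d%:R / 2 + 1) / m)%:E)%E.
Proof.
exists (196 * 12 * 2); split=> [|d n]; first by rewrite !mulr_gt0.
move=> d0 n0 mu m m0 mn.
have n0' : 0 < n%:R :> R by rewrite ltr0n.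
have [kappa [kmono kle ksmall]] := coordinate_quantile_cells mu n0.
pose cell := grid_cell n kappa.
have mcell c : measurable (cell @^-1` [set c]) by exact: measurable_grid_cell.
pose p c : R := fine (mu (cell @^-1` [set c])).
have p0 c : 0 <= p c by exact: fine_ge0.
have p1 : \sum_c p c = 1.
  have [_] := measure_cells mu xpredT mcell.
  rewrite (_ : [set x | _] = setT); last by apply/seteqP; split.
  rewrite probability_setT /= => ->.
  by apply: eq_bigr => c _; rewrite mulr1.
(* Enough levels to express every cut, up to 2 n + 1. *)
pose J := up_log 2 n.*2.+2.
have J0 : (0 < J)%N by rewrite up_log_gt0.
have Jlt : (n.*2.+1 < 2 ^ J)%N by exact: up_logP.
pose W : R := (J ^ d)%:R.
have W0 : 0 < W by rewrite ltr0n expn_gt0 J0.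
pose l : R := ln (2 * n%:R).
have l2 : 2^-1 <= l.
  apply: le_trans (ln2_ge_half R) _; rewrite ler_ln ?posrE ?mulr_gt0 //.
  by rewrite ler_pMr // ler1n.
pose delta := m / n%:R.
have delta_itv : 0 < delta <= 1 by rewrite divr_gt0 //= ler_pdivrMr // mul1r.
have /andP[delta0 delta1] := delta_itv.
have d1 : 1 <= d%:R :> R by rewrite ler1n.
(* Chosen so that delta c / (32 W) = 6 d l, which makes the tail (2 n)^(-6 d). *)
pose c := 32 * W / delta * (6 * d%:R * l).
have dl : 2^-1 <= d%:R * l by rewrite -[leLHS]mul1r ler_pM.
have c0 : 0 < c by rewrite /c !mulr_gt0 ?invr_gt0 //; lra.
have clarge : 2 * W * (delta / c) <= 1.
  rewrite mulrA ler_pdivrMr // mul1r /c.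
  have Wd : W <= W / delta by rewrite ler_peMr ?(ltW W0) // invf_ge1.
  rewrite (_ : 32 * W / delta * _ = 192 * (d%:R * l) * (W / delta)); last by ring.
  apply: (@le_trans _ _ (96 * (W / delta))); first by nra.
  by apply: ler_wpM2r; [rewrite divr_ge0 // ltW | lra].
(* The walk lives in the space indexed by dyadic boxes; pairing with [a t] tests whether a cell lies
   below the cut [t]. *)
pose b (x : grid n kappa) :=
  @box_cell R d J n.*2.+1 (fun i => sval x i : nat).
pose a (t : {ffun 'I_d -> 'I_n.*2.+2}) :=
  @box_cut R d J n.*2.+1 (fun i => t i : nat).
have gram x z : 0 <= dot (b x) (b z) <= W by exact: box_cell_gram.
have norm t : dot (a t) (a t) <= W by exact: box_cut_norm.
have ab t x : dot (a t) (b x) = (below (fun i => t i) x)%:R.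
  apply: dot_box_cut_cell => i; last exact: ltn_ord.
  by apply: leq_trans Jlt; exact: ltn_ord.
have [k [k0 k1 changes deviation]] :=
  balanced_coupling p0 p1 delta_itv c0 W0 gram clarge n norm.
(* The algorithm is built from [mu] and [m] before the sample space is introduced. *)
exists (played_algorithm (@grid_rep _ _ _ kappa) mcell k0 k1).
move=> disp Omega P X iidX Y; split.
  apply: le_trans (expectation_played_le mcell k0 k1
    (Phi := fun x y => (num_changed x y)%:R)
    (F := fun xs ys => (num_changed xs ys)%:R) iidX _ _ _) _ => //.
    by move=> x ys; rewrite ler_nat num_changed_realize.
  by rewrite lee_fin (le_trans changes) // mulrC divfK // gt_eqF.
(* Off the failure event the discrepancy is at most c / n + d / n; on it, the trivial bound 1 is
   added. *)
apply: le_trans (expectation_played_le mcell k0 k1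
  (Phi := fun _ y => orthant_discrepancy mu y)
  (F := fun _ ys => c / n%:R + d%:R / n%:R +
     [exists t : {ffun 'I_d -> 'I_n.*2.+2},
        c < `|cell_deviation mu ys (fun i => t i)|]%:R) iidX _ _ _) _ => //.
- by move=> xs ys; rewrite addr_ge0 // addr_ge0 // divr_ge0 // ltW.
- by move=> x y; case/andP: (orthant_discrepancy_itv mu n0 y).
- move=> x ys; set y := realize _ _ _ _.
  have ysE : cells cell y = ys by apply: cells_realize; exact: grid_repK.
  have [|] := boolP [exists t : {ffun 'I_d -> 'I_n.*2.+2},
    c < `|cell_deviation mu ys (fun i => t i)|].
    move=> _; apply: (@le_trans _ _ 1).
      by case/andP: (orthant_discrepancy_itv mu n0 y).
    by rewrite lerDr addr_ge0 // divr_ge0 // ltW.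
  move=> /existsPn dev; rewrite addr0.
  apply: (orthant_discrepancy_le n0 kmono kle ksmall) => t.
  by rewrite -/cell ysE leNgt dev.
rewrite lee_fin coupling_mean_cstD //.
apply: le_trans (error_bound d0 n0 (_ : 0 < m <= n%:R) (up_log_le_ln R n0)); last by rewrite m0.
rewrite lerD2l.
(* The failure probability is at most 1 / n, the third term of the error bound. *)
apply: le_trans (_ : coupling_mean _ _ _ <= _) _; last first.
- apply: le_trans deviation _.
  have -> : delta * c / (32 * W) = 6 * d%:R * l.
    by rewrite /c; field; rewrite !gt_eqF.
  have N0 : 0 < 2 * n%:R :> R by rewrite mulr_gt0.
  rewrite expRN (_ : 6 * d%:R * l = ln ((2 * n%:R) ^+ (6 * d))); last first.
    by rewrite lnXn // -[RHS]mulr_natl natrM.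
  rewrite lnK ?posrE ?exprn_gt0 // ler_pdivrMr ?exprn_gt0 // -(ler_pM2l n0').
  rewrite mulrA mulfV ?gt_eqF // mul1r -!natrM -natrX ler_nat.
  by apply: failure_count_le => //; [exact: card_grid | rewrite card_ffun !card_ord].
- rewrite le_eqVlt; apply/orP; left; apply/eqP.
  apply: eq_bigr => xs _; apply: eq_bigr => ys _; congr (_ * (nat_of_bool _)%:R).
  apply: eq_existsb => t; congr (_ < `|_|); apply: eq_bigr => y _.
  by rewrite ab; congr (_ - _); apply: eq_bigr => x _; rewrite ab.
Qed.
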